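(* Let $u_1,\dots,u_n$ be unit vectors forming a basis of $\mathbb{R}^n$, let $T$ be the conical Radon transform over the boundaries of the polyhedral cones generated by $u_1,\dots,u_n$, and let $\alpha,y_1$ be the associated unit vectors (defined in the context). For $f\in L^1(\mathbb{R}^n)$ let $$F(x)=\langle\alpha,y_1\rangle\int_0^\infty (Tf)(x+t\alpha)\,dt ,$$ and set $v_i=-u_i$, $i=1,\dots,n$. Then $f$ is recovered from $Tf$ as follows. (i) If $f\in L^1(\mathbb{R}^n)$, then for almost every $x\in\mathbb{R}^n$ $$f(x)=\lim_{t\to0}\frac{1}{t^n|\det(v_1,\dots,v_n)|}\sum_{\sigma\in\{-\frac12,\frac12\}^n}\operatorname{sgn}(\sigma_1\cdots\sigma_n)\,F(x+\sigma_1tv_1+\dots+\sigma_ntv_n).$$ (ii) If $f\in C_c(\mathbb{R}^n)$, then for every $x\in\mathbb{R}^n$ $$f(x)=\frac{1}{|\det(v_1,\dots,v_n)|}\,\frac{\partial}{\partial v_1}\cdots\frac{\partial}{\partial v_n}F(x).$$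
   Context: $C(x)=\{x+\sum_{i=1}^nc_iu_i:c_i\ge0\}$ is the polyhedral cone with vertex $x$, and the conical Radon transform of $f$ is $(Tf)(x)=\int_{\partial C(x)}f\,dS$, where $dS$ is the $(n-1)$-dimensional Lebesgue measure on $\partial C(x)$; for $f\in L^1(\mathbb{R}^n)$ it is defined for almost every $x$. $\alpha$ is the unique unit vector which, starting from the vertex of the cone, points inside the cone and has the same angle $\beta$ with all $n$ faces of the cone. $X_i=\operatorname{span}\langle u_1,\dots,u_{i-1},u_{i+1},\dots,u_n\rangle$, and $y_i$ is the unit vector in $X_i^\perp$ with $\langle\alpha,y_i\rangle=\sin\beta$ for $i=1,\dots,n$. $\frac{\partial}{\partial v_j}$ is the directional derivative in the direction $v_j$. *)

(* Defs.v *)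
From HB Require Import structures.
From mathcomp Require Import all_boot all_order all_algebra.
From mathcomp Require Import all_classical all_reals all_analysis.
From mathcomp Require Import measurable_realfun.

Set Implicit Arguments.
Unset Strict Implicit.
Unset Printing Implicit Defensive.
Import Order.TTheory GRing.Theory Num.Theory.
Import numFieldNormedType.Exports.

Local Open Scope classical_set_scope.
Local Open Scope ring_scope.

(* R^n is 'rV[R]_n.  Its sigma-algebra is generated by the coordinate maps; it
   consists of the Borel sets of R^n. *)
Fact rV_display : measure_display. Proof. exact: default_measure_display. Qed.

Section measurable_rV.
Context {R : realType} (n : nat).

Let coor (i : 'I_n) (x : 'rV[R]_n) : measurableTypeR R := x ord0 i.

Let rV_set0 : g_sigma_preimage coor set0.
Proof. exact: sigma_algebra0. Qed.

Let rV_setC A : g_sigma_preimage coor A -> g_sigma_preimage coor (~` A).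
Proof. exact: sigma_algebraC. Qed.

Let rV_bigcup (F : (set 'rV[R]_n)^nat) :
  (forall i, g_sigma_preimage coor (F i)) ->
  g_sigma_preimage coor (\bigcup_i (F i)).
Proof. exact: sigma_algebra_bigcup. Qed.

HB.instance Definition _ := @isMeasurable.Build rV_display 'rV[R]_n
  (g_sigma_preimage coor) rV_set0 rV_setC rV_bigcup.

Lemma measurable_coor (i : 'I_n) :
  measurable_fun [set: 'rV[R]_n] (fun x => x ord0 i : measurableTypeR R).
Proof.
move=> _ Y mY; rewrite setTI; apply: sub_sigma_algebra => /=.
rewrite -bigcup_seq/=; exists i => /=; first by rewrite mem_index_enum.
by exists Y => //; rewrite setTI.
Qed.

Lemma measurable_fun_rV d (T : measurableType d) (f : T -> 'rV[R]_n) :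
  (forall i, measurable_fun [set: T] (fun t => f t ord0 i : measurableTypeR R)) ->
  measurable_fun [set: T] f.
Proof.
move=> mf; pose G := \big[setU/set0]_(i < n)
  preimage_set_system setT (coor i) measurable.
apply: (@measurability _ _ T 'rV[R]_n setT f G) => //= _ [A GA <-].
move: GA; rewrite /G -bigcup_seq/= => -[i _ [B mB <-]].
by rewrite !setTI -[X in measurable X]setTI; exact: mf.
Qed.

End measurable_rV.

Section lebesgue_rV.
Context {R : realType}.

Definition cons_rV n (p : measurableTypeR R * 'rV[R]_n) : 'rV[R]_n.+1 :=
  \row_(i < n.+1) if unlift ord0 i is Some j then p.2 ord0 j else p.1.

Definition uncons_rV n (x : 'rV[R]_n.+1) : measurableTypeR R * 'rV[R]_n :=
  (x ord0 ord0, \row_(j < n) x ord0 (lift ord0 j)).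

Lemma cons_rVK n : cancel (@cons_rV n) (@uncons_rV n).
Proof.
case=> a x; rewrite /uncons_rV !mxE unlift_none /=; congr pair.
by apply/rowP => j; rewrite !mxE liftK.
Qed.

Lemma measurable_cons_rV n : measurable_fun setT (@cons_rV n).
Proof.
apply: measurable_fun_rV => i; case: (unliftP ord0 i) => [j ->|->].
  under eq_fun do rewrite mxE liftK.
  exact: (measurableT_comp (@measurable_coor R n j) measurable_snd).
under eq_fun do rewrite mxE unlift_none.
exact: measurable_fst.
Qed.

Lemma measurable_uncons_rV n : measurable_fun setT (@uncons_rV n).
Proof.
apply/measurable_fun_pairP; split; first exact: measurable_coor.
apply: measurable_fun_rV => j.
rewrite (_ : (fun t => _) = fun x : 'rV[R]_n.+1 => x ord0 (lift ord0 j)).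
  exact: measurable_coor.
by apply/funext => x; rewrite /= mxE.
Qed.

Section step.
Variables (n : nat) (mu : {sigma_finite_measure set 'rV[R]_n -> \bar R}).

Definition cons_measure : set 'rV[R]_n.+1 -> \bar R :=
  pushforward (@lebesgue_measure R \x mu)%E (@cons_rV n).

Let cons_measure0 : cons_measure set0 = 0%E.
Proof. by rewrite /cons_measure /pushforward preimage_set0 measure0. Qed.

Let cons_measure_ge0 A : (0 <= cons_measure A)%E.
Proof. by rewrite /cons_measure /pushforward; exact: measure_ge0. Qed.

Let cons_measure_sigma_additive : semi_sigma_additive cons_measure.
Proof.
by have mf := @measurable_cons_rV n; exact: measure_semi_sigma_additive.
Qed.

HB.instance Definition _ := isMeasure.Build _ _ _ cons_measure
  cons_measure0 cons_measure_ge0 cons_measure_sigma_additive.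

Let cons_measure_sigma_finite : sigma_finite setT cons_measure.
Proof.
have /sigma_finiteP[F [FT ndF Foo]] := sigma_finiteT (@lebesgue_measure R).
have /sigma_finiteP[G [GT ndG Goo]] := sigma_finiteT mu.
exists (fun k => @uncons_rV n @^-1` (F k `*` G k)).
  rewrite -preimage_bigcup (_ : \bigcup_k _ = setT) ?preimage_setT//.
  apply/seteqP; split => // -[a x] _.
  have [i _ Fi] : (\bigcup_i F i) a by rewrite -FT.
  have [j _ Gj] : (\bigcup_i G i) x by rewrite -GT.
  exists (maxn i j) => //; split => /=.
    by move: a Fi; exact/subsetPset/ndF/leq_maxl.
  by move: x Gj; exact/subsetPset/ndG/leq_maxr.
move=> k; have [mF Fk] := Foo k; have [mG Gk] := Goo k.
have mFG : measurable (F k `*` G k) by exact: measurableX.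
split.
  by rewrite -[X in measurable X]setTI; exact: measurable_uncons_rV.
rewrite /cons_measure /pushforward -comp_preimage.
rewrite (_ : _ \o _ = id); last by apply/funext => p; rewrite /= cons_rVK.
by rewrite preimage_id product_measure1E// lte_mul_pinfty// ge0_fin_numE.
Qed.

HB.instance Definition _ := Measure_isSigmaFinite.Build _ _ _ cons_measure
  cons_measure_sigma_finite.

End step.

(* n-dimensional Lebesgue measure: the n-fold product of the one-dimensional
   one (a unit mass at the only point when n = 0). *)
Fixpoint lebesgue_rV n : {sigma_finite_measure set 'rV[R]_n -> \bar R} :=
  match n with
  | 0 => \d_(0 : 'rV[R]_0)
  | m.+1 => cons_measure (lebesgue_rV m)
  end.

End lebesgue_rV.

Section euclidean.
Context {R : realType} (n : nat).
Implicit Types x y : 'rV[R]_n.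

Definition dotp x y : R := \sum_i x ord0 i * y ord0 i.

(* The norm `|x| of 'rV[R]_n is the sup norm. *)
Definition enorm x : R := Num.sqrt (dotp x x).

Definition angle x y : R := acos (dotp x y / (enorm x * enorm y)).

Definition orthogonal (X : {vspace 'rV[R]_n}) y :=
  forall w, w \in X -> dotp w y = 0.

Definition frontier (A : set 'rV[R]_n) := closure A `\` A°.

Definition L1 (f : 'rV[R]_n -> R) :=
  (lebesgue_rV n).-integrable setT (EFin \o f).

Definition Cc (f : 'rV[R]_n -> R) :=
  continuous f /\ compact (closure [set x | f x != 0]).

End euclidean.

Section cone.
Context {R : realType} (m : nat).
Local Notation n := m.+1.
Implicit Types (u : 'I_n -> 'rV[R]_n) (x alpha : 'rV[R]_n).

Definition unit_basis u :=
  basis_of fullv [tuple u i | i < n] /\ forall i, enorm (u i) = 1.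

Definition cone u x : set 'rV[R]_n :=
  [set y | exists2 c : 'I_n -> R, (forall i, 0 <= c i) &
           y = x + \sum_i c i *: u i].

Definition face_space u (i : 'I_n) : {vspace 'rV[R]_n} :=
  <<[seq u j | j in predC1 i]>>%VS.

(* The angle between a vector and the hyperplane X is the complement of its
   angle with the normal line of X.  For the axis of a cone it is also the
   angle with the face itself, as the axis projects orthogonally into it. *)
Definition hyperplane_angle (X : {vspace 'rV[R]_n}) alpha (beta : R) :=
  exists N, [/\ N != 0, orthogonal X N & beta = `|pi / 2 - angle alpha N|].

Definition cone_axis u alpha (beta : R) :=
  [/\ enorm alpha = 1, (cone u 0)° alpha &
      forall i, hyperplane_angle (face_space u i) alpha beta].

Definition face_normal u alpha (beta : R) (i : 'I_n) y :=
  [/\ enorm y = 1, orthogonal (face_space u i) y & dotp alpha y = sin beta].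

Section face_measure.
Variables (u : 'I_n -> 'rV[R]_n) (i : 'I_n) (x : 'rV[R]_n).

Definition face_param (c : 'rV[R]_m) : 'rV[R]_n :=
  x + \sum_(j < m) c ord0 j *: u (lift i j).

Definition face_gram : 'M[R]_m :=
  \matrix_(j, k) dotp (u (lift i j)) (u (lift i k)).

Definition face_density : {nonneg R} := NngNum (sqrtr_ge0 (\det face_gram)).

Lemma measurable_face_param : measurable_fun setT face_param.
Proof.
apply: measurable_fun_rV => k.
rewrite (_ : (fun _ => _) = fun c : 'rV[R]_m =>
    x ord0 k + \sum_(j < m) c ord0 j * u (lift i j) ord0 k); last first.
  apply/funext => c; rewrite /face_param mxE summxE; congr (_ + _).
  by apply: eq_bigr => j _; rewrite mxE.
apply: measurable_funD; first exact: measurable_cst.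
elim: (index_enum _) => [|j s ih].
  by under eq_fun do rewrite big_nil; exact: measurable_cst.
under eq_fun do rewrite big_cons.
apply: measurable_funD ih; apply: measurable_funM; last exact: measurable_cst.
exact: measurable_coor.
Qed.

Definition face_push : set 'rV[R]_n -> \bar R :=
  pushforward (lebesgue_rV m) face_param.

Let face_push0 : face_push set0 = 0%E.
Proof. by rewrite /face_push /pushforward preimage_set0 measure0. Qed.

Let face_push_ge0 A : (0 <= face_push A)%E.
Proof. by rewrite /face_push /pushforward; exact: measure_ge0. Qed.

Let face_push_sigma_additive : semi_sigma_additive face_push.
Proof.
by have mf := measurable_face_param; exact: measure_semi_sigma_additive.
Qed.

HB.instance Definition _ := isMeasure.Build _ _ _ face_push
  face_push0 face_push_ge0 face_push_sigma_additive.

(* m-dimensional Lebesgue measure of the affine hyperplane x + X_i, seen as a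
   measure on R^n carried by that hyperplane; the Gram factor is the area
   element of the parametrization. *)
Definition face_measure : set 'rV[R]_n -> \bar R :=
  mscale face_density face_push.

HB.instance Definition _ := Measure.on face_measure.

End face_measure.

(* The integral over the boundary of the cone, taken face by face: faces
   overlap in dimension < m. *)
Definition conical_radon u (f : 'rV[R]_n -> R) x : R :=
  \sum_(i < n) \int[face_measure u i x]_(y in frontier (cone u x)) f y.

Definition axis_transform u alpha y1 (f : 'rV[R]_n -> R) x : R :=
  dotp alpha y1 *
  \int[lebesgue_measure]_(t in `[0, +oo[) conical_radon u f (x + t *: alpha).

End cone.

Section directional.
Context {R : realType} {V : normedModType R}.
Implicit Types (s : seq V) (F : V -> R).

(* iter_derive [:: v1; ...; vn] F = d/dv1 (... (d/dvn F)) *)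
Fixpoint iter_derive s F : V -> R :=
  if s is v :: s' then fun x => 'D_v (iter_derive s' F) x else F.

(* All the directional derivatives involved in iter_derive s F exist. *)
Fixpoint iter_derivable s F : Prop :=
  if s is v :: s' then
    iter_derivable s' F /\ forall x, derivable (iter_derive s' F) x v
  else True.

End directional.

(* The two values of {-1/2, 1/2}, indexed by bool. *)
Definition half_sign {R : realType} (b : bool) : R := (-1) ^+ b / 2.

(* Main.v *)
Require Import Defs.
From mathcomp Require Import all_boot all_order all_algebra.
From mathcomp Require Import all_classical all_reals all_analysis.
From mathcomp Require Import measurable_realfun ring lra.
Set Implicit Arguments.
Unset Strict Implicit.
Unset Printing Implicit Defensive.
Import Order.TTheory GRing.Theory Num.Theory.
Import numFieldNormedType.Exports.
Local Open Scope classical_set_scope.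
Local Open Scope ring_scope.

(** Why the inversion formulas hold. Write the points of R^n in the basis u as
    x + sum_i c_i u_i, so that the cone C(x) is the orthant c >= 0, and let a be
    the coordinates of the axis alpha; they are positive because alpha points
    inside the cone. Moving the boundary of the cone along alpha sweeps the
    cone: the point reached from the i-th face at time t has c_i = t a_i and
    c_j >= t a_j for the other j, so the i-th face sweeps the sector where
    c_i / a_i is minimal, and the sectors tile the orthant up to null sets. The
    Jacobian of this parametrization is, on the one hand, the area of the face
    frame times the sine of the common angle beta between alpha and the faces
    and, on the other hand, a_i |det u| (axis_face_volume). Hence, for f in L1
    and every x,

      F(x) = |det u| * integral over c >= 0 of f(x + sum_i c_i u_i),

    which is the integral of f over C(x) (axis_transform_cone).

    For the first formula, evaluate this at the corners of a cube of side |t| in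
    the coordinates c. The signed sum of the indicators of the translated
    orthants is the indicator of the cube, up to the sign of t^n, so the quotient
    in the formula is exactly the average of f over a parallelotope around x
    (corner_sum). It converges almost everywhere by the Lebesgue differentiation
    theorem for cubes (lebesgue_differentiation_cubes), proved here from a Vitali
    covering argument, the maximal inequality and a Dynkin induction; linear
    bijections carry null sets to null sets (lebesgue_rV_unitmx).

    For the second formula, the integral over the orthant is an iterated integral
    along the rays of directions u_i. By the fundamental theorem of calculus, the
    derivative along - u_i undoes the integral along u_i (derive_ray_integral),
    and n such steps recover |det u| f (iter_derive_orthant_integral). Compact
    supports are not preserved by these integrals, but continuity together with
    boundedness of the coordinates from above on the support is
    (cone_supported_ray_integral).

    Both parts use that the image of Lebesgue measure by a linear bijection is a
    multiple of it. This follows from uniqueness of Haar measure by Tonelli's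
    theorem (lebesgue_rV_additive), which also computes the constants needed for
    the sectors without a general formula for determinants. *)

(** * Change of variables and product measures *)

Section change_of_variables.
Context d1 d2 (T1 : measurableType d1) (T2 : measurableType d2) (R : realType).
Variables (mu : {measure set T1 -> \bar R}) (nu : {measure set T2 -> \bar R}).
Variables (phi : T1 -> T2) (k : {nonneg R}).
Hypothesis mphi : measurable_fun setT phi.
Hypothesis muE : forall E, measurable E ->
  (mu (phi @^-1` E) = k%:num%:E * nu E)%E.
Local Open Scope ereal_scope.

Lemma ge0_integral_comp (f : T2 -> \bar R) : measurable_fun setT f ->
  (forall y, 0 <= f y) ->
  \int[mu]_x f (phi x) = k%:num%:E * \int[nu]_y f y.
Proof.
move=> mf f0.
rewrite -[in LHS](preimage_setT phi) -(@ge0_integral_pushforward _ _ _ _ _ phi)//.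
rewrite -ge0_integral_mscale//.
by apply: eq_measure_integral => //= A mA _; exact: muE.
Qed.

(** An equality of extended reals, whether or not f is integrable: it holds for
    the positive and the negative parts, and multiplication by a finite
    nonnegative constant commutes with their subtraction even when both are
    infinite. *)
Lemma integral_comp (f : T2 -> \bar R) : measurable_fun setT f ->
  \int[mu]_x f (phi x) = k%:num%:E * \int[nu]_y f y.
Proof.
move=> mf; rewrite [in RHS]integralE.
transitivity (\int[mu]_x f^\+ (phi x) - \int[mu]_x f^\- (phi x)).
  by rewrite integralE; congr (_ - _); apply: eq_integral => x _;
    rewrite ?funeposE ?funenegE.
rewrite (ge0_integral_comp (measurable_funepos mf))//.
rewrite (ge0_integral_comp (measurable_funeneg mf))//.
have [->|k0] := eqVneq k%:num%R 0%R; first by rewrite !mul0e sube0.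
have {k0} : (0 < k%:num)%R by rewrite lt0r k0/=.
case: (\int[nu]_y f^\+ y) => [a| |]; case: (\int[nu]_y f^\- y) => [b| |] k0 //=;
  rewrite ?(gt0_muley,gt0_muleNy) ?lte_fin//=.
- by congr EFin; rewrite mulrBr.
all: by rewrite /= ?(gt0_muley,gt0_muleNy) ?lte_fin.
Qed.

Lemma integrable_comp (f : T2 -> \bar R) :
  nu.-integrable setT f -> mu.-integrable setT (f \o phi).
Proof.
case/integrableP => mf ioo; apply/integrableP; split.
  exact: measurableT_comp.
rewrite (@ge0_integral_comp (fun y => `|f y|))//; last exact: measurableT_comp.
by rewrite lte_mul_pinfty ?lee_fin// ge0_fin_numE// integral_ge0.
Qed.

End change_of_variables.

Section unit_jacobian.
Context d1 d2 (T1 : measurableType d1) (T2 : measurableType d2) (R : realType).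
Variables (mu : {measure set T1 -> \bar R}) (nu : {measure set T2 -> \bar R}).
Variables (phi : T1 -> T2).
Hypothesis mphi : measurable_fun setT phi.
Hypothesis muE : forall E, measurable E -> mu (phi @^-1` E) = nu E.
Local Open Scope ereal_scope.

Let muE1 E : measurable E -> mu (phi @^-1` E) = (1%R%:nng)%:num%:E * nu E.
Proof. by move=> mE; rewrite mul1e muE. Qed.

Lemma integral_comp1 (f : T2 -> \bar R) : measurable_fun setT f ->
  \int[mu]_x f (phi x) = \int[nu]_y f y.
Proof. by move=> mf; rewrite (integral_comp mphi muE1)// mul1e. Qed.

Lemma integrable_comp1 (f : T2 -> \bar R) :
  nu.-integrable setT f -> mu.-integrable setT (f \o phi).
Proof. exact: (integrable_comp mphi muE1). Qed.

End unit_jacobian.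

Section product_map.
Context d1 d2 (T1 : measurableType d1) (T2 : measurableType d2) (R : realType).
Variables (m1 : {sigma_finite_measure set T1 -> \bar R}).
Variables (m2 : {sigma_finite_measure set T2 -> \bar R}).
Variables (p : T1 -> T1) (q : T2 -> T2).
Hypothesis mp : measurable_fun setT p.
Hypothesis mq : measurable_fun setT q.
Hypothesis m1E : forall E, measurable E -> m1 (p @^-1` E) = m1 E.
Hypothesis m2E : forall E, measurable E -> m2 (q @^-1` E) = m2 E.

Lemma product_measure_map_pair E : measurable E ->
  (m1 \x m2)%E ((fun z => (p z.1, q z.2)) @^-1` E) = (m1 \x m2)%E E.
Proof.
move=> mE; apply/esym.
have mpq : measurable_fun setT (fun z : T1 * T2 => (p z.1, q z.2)).
  by apply/measurable_fun_pair; exact: measurableT_comp.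
have -> : (m1 \x m2)%E ((fun z => (p z.1, q z.2)) @^-1` E) =
  pushforward (m1 \x m2)%E (fun z => (p z.1, q z.2)) E by [].
apply: product_measure_unique => // A B mA mB.
have mpA : measurable (p @^-1` A) by rewrite -[X in measurable X]setTI; exact: mp.
have mqB : measurable (q @^-1` B) by rewrite -[X in measurable X]setTI; exact: mq.
rewrite /= /pushforward (_ : _ @^-1` _ = (p @^-1` A) `*` (q @^-1` B))//.
rewrite product_measure1E//; congr (_ * _)%E; [exact: m1E|exact: m2E].
Qed.

End product_map.

(** * Lebesgue measure of isometric images, boxes and hyperplanes *)

Section lebesgue_invariance.
Context {R : realType}.
Notation leb1 := (@lebesgue_measure R).

(** Translations and reflections are treated together, the boolean being the
    sign of the linear part. *)
Lemma measurable_signed_shift (b : bool) (v : measurableTypeR R) :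
  measurable_fun setT (fun x : measurableTypeR R => (-1) ^+ b * x + v :
    measurableTypeR R).
Proof.
apply: measurable_funD; last exact: measurable_cst.
by apply: measurable_funM; [exact: measurable_cst|exact: measurable_id].
Qed.

Lemma lebesgue_measure_signed_shift (b : bool) (v : measurableTypeR R)
    (E : set (measurableTypeR R)) : measurable E ->
  leb1 ((fun x => (-1) ^+ b * x + v) @^-1` E) = leb1 E.
Proof.
move=> mE; apply/esym.
have ms := measurable_signed_shift b v.
pose s (x : measurableTypeR R) : measurableTypeR R := (-1) ^+ b * x + v.
rewrite -[RHS]/(pushforward leb1 s E).
apply: lebesgue_measure_unique => // _ [[x y] _ <-] /=; rewrite /pushforward {}/s.
case: b {ms} => /=.
  rewrite (_ : _ @^-1` _ = `[v - y, v - x[%classic); last first.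
    apply/seteqP; split=> z /=; rewrite !in_itv/= expr1 mulN1r => /andP[? ?];
    by apply/andP; split; lra.
  rewrite !lebesgue_measure_itv/= !lte_fin ltrD2l ltrN2.
  by case: ifP => // _; rewrite -!EFinB; congr EFin; ring.
rewrite (_ : _ @^-1` _ = `]x - v, y - v]%classic); last first.
  apply/seteqP; split=> z /=; rewrite !in_itv/= expr0 mul1r => /andP[? ?];
  by apply/andP; split; lra.
rewrite !lebesgue_measure_itv/= !lte_fin ltrD2r.
by case: ifP => // _; rewrite -!EFinB; congr EFin; ring.
Qed.

Lemma measurable_signed_shift_rV n (b : bool) (v : 'rV[R]_n) :
  measurable_fun setT (fun x : 'rV[R]_n => (-1) ^+ b *: x + v).
Proof.
apply: measurable_fun_rV => i.
under eq_fun do rewrite !mxE.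
exact: (measurableT_comp (measurable_signed_shift b (v ord0 i))
  (measurable_coor i)).
Qed.

Lemma lebesgue_rVS n (E : set 'rV[R]_n.+1) :
  lebesgue_rV n.+1 E = (leb1 \x lebesgue_rV n)%E (@cons_rV R n @^-1` E).
Proof. by []. Qed.

Lemma lebesgue_rV_signed_shift n (b : bool) (v : 'rV[R]_n) (E : set 'rV[R]_n) :
  measurable E ->
  lebesgue_rV n ((fun x => (-1) ^+ b *: x + v) @^-1` E) = lebesgue_rV n E.
Proof.
elim: n => [|n ih] in v E *.
  suff -> : (fun x : 'rV[R]_0 => (-1) ^+ b *: x + v) = id by [].
  by apply/funext => x; apply/rowP; case.
move=> mE; rewrite !lebesgue_rVS.
pose w := @uncons_rV R n v.
have mcE : measurable (@cons_rV R n @^-1` E).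
  by rewrite -[X in measurable X]setTI; exact: measurable_cons_rV.
rewrite -[RHS](product_measure_map_pair (measurable_signed_shift b w.1)
  (measurable_signed_shift_rV b w.2) (lebesgue_measure_signed_shift b w.1)
  (ih w.2) mcE).
congr (product_measure1 _ _ _); apply/funext => z /=; congr E.
apply/rowP => i; rewrite !mxE; case: unliftP => [j ->|->]; rewrite ?mxE//.
Qed.

Lemma lebesgue_rV_shift n (v : 'rV[R]_n) (E : set 'rV[R]_n) : measurable E ->
  lebesgue_rV n ((fun x => x + v) @^-1` E) = lebesgue_rV n E.
Proof.
move=> mE; rewrite -[RHS](lebesgue_rV_signed_shift false v)//.
by congr (lebesgue_rV n _); apply/funext => x /=; rewrite expr0 scale1r.
Qed.

Lemma lebesgue_rV_reflect n (v : 'rV[R]_n) (E : set 'rV[R]_n) : measurable E ->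
  lebesgue_rV n ((fun x => v - x) @^-1` E) = lebesgue_rV n E.
Proof.
move=> mE; rewrite -[RHS](lebesgue_rV_signed_shift true v)//.
by congr (lebesgue_rV n _); apply/funext => x /=; rewrite expr1 scaleN1r addrC.
Qed.

Lemma measurable_shift_rV n (v : 'rV[R]_n) :
  measurable_fun setT (fun x : 'rV[R]_n => x + v).
Proof.
have := measurable_signed_shift_rV false v.
by under eq_fun do rewrite expr0 scale1r.
Qed.

Lemma measurable_reflect_rV n (v : 'rV[R]_n) :
  measurable_fun setT (fun x : 'rV[R]_n => v - x).
Proof.
have := measurable_signed_shift_rV true v.
by under eq_fun do rewrite expr1 scaleN1r addrC.
Qed.

Lemma measurable_box n (B : 'I_n -> set (measurableTypeR R)) :
  (forall i, measurable (B i)) ->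
  measurable [set x : 'rV[R]_n | forall i, B i (x ord0 i)].
Proof.
move=> mB; rewrite (_ : [set x | _] =
    \big[setI/setT]_(i < n) ((fun x : 'rV[R]_n => x ord0 i) @^-1` B i)).
  apply: bigsetI_measurable => i _; rewrite -[X in measurable X]setTI.
  exact: measurable_coor.
rewrite -bigcap_seq; apply/seteqP; split=> x /= Bx i => [_|]; first exact: Bx.
by apply: Bx; rewrite /= mem_index_enum.
Qed.

Lemma lebesgue_rV_box n (B : 'I_n -> set (measurableTypeR R)) :
  (forall i, measurable (B i)) ->
  lebesgue_rV n [set x | forall i, B i (x ord0 i)] = (\prod_i leb1 (B i))%E.
Proof.
elim: n => [|n ih] in B * => mB.
  by rewrite big_ord0 /= diracE mem_set// => -[].
rewrite lebesgue_rVS big_ord_recl -ih// -product_measure1E//; last first.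
  exact: (measurable_box (fun i => mB (lift ord0 i))).
congr (product_measure1 _ _ _); apply/seteqP; split=> -[a x]/=.
  move=> Bx; split => [|i].
    by have := Bx ord0; rewrite mxE unlift_none.
  by have := Bx (lift ord0 i); rewrite mxE liftK.
by move=> [Ba Bx] i; rewrite mxE; case: unliftP => [j ->|->].
Qed.

Lemma ler_coord_norm n (x : 'rV[R]_n) i : `|x ord0 i| <= `|x|.
Proof.
rewrite [leRHS]mx_normrE.
by rewrite (le_bigmax _ (fun i : 'I_1 * 'I_n => `|x i.1 i.2|) (ord0, i)).
Qed.

Lemma measurable_hyperplane n (i : 'I_n) (b : R) :
  measurable [set x : 'rV[R]_n | x ord0 i = b].
Proof.
rewrite -[X in measurable X]setTI.
exact: (@measurable_coor R n i measurableT [set b]).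
Qed.

(** A hyperplane is a countable union of boxes with one degenerate side. *)
Lemma lebesgue_rV_hyperplane n (i : 'I_n) (b : R) :
  lebesgue_rV n [set x : 'rV[R]_n | x ord0 i = b] = 0%E.
Proof.
pose B k j : set (measurableTypeR R) :=
  if j == i then [set b] else `[- k%:R, k%:R]%classic.
have mB k j : measurable (B k j) by rewrite /B; case: ifP.
apply/(negligibleP (lebesgue_rV n) (measurable_hyperplane i b)).
have cov : [set x : 'rV[R]_n | x ord0 i = b] `<=`
    \bigcup_k [set x : 'rV[R]_n | forall j, B k j (x ord0 j)].
  move=> x /= xib; exists (Num.truncn `|x|).+1 => // j.
  rewrite /B; case: eqVneq => [->//|_] /=; rewrite in_itv/= -ler_norml.
  exact: le_trans (ler_coord_norm x j) (ltW (truncnS_gt _)).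
apply: negligibleS cov _; apply: negligible_bigcup => k; apply/negligibleP;
  first exact: measurable_box.
rewrite [LHS](lebesgue_rV_box (mB k))
  (bigD1 i)//= {1}/B eqxx lebesgue_measure_set1 mul0e//.
Qed.

End lebesgue_invariance.

(** * Uniqueness of Haar measure and linear maps *)

Section haar_uniqueness.
Context {R : realType} (n : nat) (phi : 'rV[R]_n -> 'rV[R]_n).
Notation leb := (lebesgue_rV n : {sigma_finite_measure set 'rV[R]_n -> \bar R}).
Hypothesis mphi : measurable_fun setT phi.
Hypothesis phiB : {morph phi : x y / x - y}.
Hypothesis phi_surj : forall x, exists y, phi y = x.

Let preimage_shift (Q : set 'rV[R]_n) x : measurable Q ->
  leb [set y | Q (phi y - x)] = leb (phi @^-1` Q).
Proof.
move=> mQ; have [y0 <-] := phi_surj x.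
have mpQ : measurable (phi @^-1` Q).
  by rewrite -[X in measurable X]setTI; exact: mphi.
rewrite -[RHS](lebesgue_rV_shift (- y0))//; congr (leb _).
by apply/funext => y /=; rewrite -phiB.
Qed.

(** Both sides are the mass of {(x, y) | x in E, phi y - x in Q}, cut along y on
    the left and along x on the right, where the sections are translates of a
    single preimage. *)
Let mass_section (E Q : set 'rV[R]_n) : measurable E -> measurable Q ->
  (\int[leb]_y leb (E `&` [set x | Q (phi y - x)%R]) =
   leb (phi @^-1` Q) * leb E)%E.
Proof.
move=> mE mQ.
pose A : set ('rV[R]_n * 'rV[R]_n) := [set z | E z.1 /\ Q (phi z.2 - z.1)].
have mA : measurable A.
  rewrite (_ : A = (E `*` setT) `&`
     ((fun z : 'rV[R]_n * 'rV[R]_n => phi z.2 - z.1) @^-1` Q)); last first.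
    by apply/seteqP; split=> -[x y] /=; [move=> [? ?]|move=> [[? _] ?]].
  apply: measurableI; first exact: measurableX.
  rewrite -[X in measurable X]setTI.
  suff : measurable_fun setT (fun z : 'rV[R]_n * 'rV[R]_n => phi z.2 - z.1).
    by apply.
  apply: measurable_fun_rV => i; under eq_fun do rewrite !mxE.
  apply: measurable_funB.
    apply: (measurableT_comp (measurable_coor i)).
    exact: (measurableT_comp mphi measurable_snd).
  exact: (measurableT_comp (measurable_coor i) measurable_fst).
have -> : (leb (phi @^-1` Q) * leb E = (leb \x leb) A)%E.
  rewrite /product_measure1 /=.
  transitivity (\int[leb]_(x in E) leb (phi @^-1` Q))%E.
    by rewrite integral_cst.
  rewrite integral_mkcond; apply: eq_integral => x _; rewrite patchE.
  case: ifPn => xE.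
    rewrite -(preimage_shift x mQ); congr (leb _).
    apply/seteqP; split => y; rewrite /xsection/= inE/=.
      by split => //; rewrite inE in xE.
    by case.
  rewrite (_ : xsection _ _ = set0) ?measure0//.
  apply/seteqP; split => y //; rewrite /xsection/= inE/= => -[Ex].
  by rewrite notin_setE in xE.
rewrite (@product_measure_unique _ _ _ _ _ leb leb (product_measure2 leb leb))//.
  rewrite /product_measure2/=; apply: eq_integral => y _; congr (leb _).
  by apply/seteqP; split => x; rewrite /ysection/= ?inE/=.
by move=> B C mB mC; rewrite /= product_measure2E.
Qed.

(** Uniqueness of Haar measure: reflecting x through phi y exchanges the roles
    of E and Q in the mass of {(x, y) | x in E, phi y - x in Q}. With Q of
    measure 1, the image of the measure by phi is a multiple of the measure. *)
Lemma lebesgue_rV_additive (E Q : set 'rV[R]_n) : measurable E -> measurable Q ->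
  (leb (phi @^-1` Q) * leb E = leb (phi @^-1` E) * leb Q)%E.
Proof.
move=> mE mQ; rewrite -!mass_section//; apply: eq_integral => y _.
have mD (D : set 'rV[R]_n) : measurable D -> measurable [set x | D (phi y - x)].
  by move=> mD; rewrite -[X in measurable X]setTI; exact: measurable_reflect_rV.
rewrite -[RHS](lebesgue_rV_reflect (phi y)); last first.
  by apply: measurableI => //; exact: mD.
congr (leb _); apply/seteqP; split => x /=; rewrite subKr; by case.
Qed.

End haar_uniqueness.

Section linear_maps.
Context {R : realType}.

Definition unit_cube n : set 'rV[R]_n :=
  [set x | forall i, `[0, 1]%classic (x ord0 i : measurableTypeR R)].

Lemma measurable_unit_cube n : measurable (@unit_cube n).
Proof.
by apply: (@measurable_box R n (fun=> `[0, 1]%classic)) => i.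
Qed.

Lemma lebesgue_rV_unit_cube n : lebesgue_rV n (@unit_cube n) = 1%E.
Proof.
rewrite (@lebesgue_rV_box R n (fun=> `[0, 1]%classic))// big1// => i _.
by rewrite lebesgue_measure_itv/= lte01 oppr0 adde0.
Qed.

Lemma measurable_linear m n (A : 'M[R]_(m, n)) :
  measurable_fun setT (fun x : 'rV[R]_m => x *m A).
Proof.
apply: measurable_fun_rV => k; under eq_fun do rewrite mxE.
elim: (index_enum _) => [|j s ih].
  by under eq_fun do rewrite big_nil; exact: measurable_cst.
under eq_fun do rewrite big_cons.
apply: measurable_funD ih; apply: measurable_funM; last exact: measurable_cst.
exact: measurable_coor.
Qed.

(** The constant, in truth 1 / |det A|, is the measure of the preimage of the
    unit cube; only its finiteness matters below, and it holds because that
    preimage is bounded. *)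
Lemma lebesgue_rV_unitmx n (A : 'M[R]_n) : A \in unitmx ->
  exists k : {nonneg R}, forall E, measurable E ->
    lebesgue_rV n ((fun x => x *m A) @^-1` E) = (k%:num%:E * lebesgue_rV n E)%E.
Proof.
move=> uA.
have hE := @lebesgue_rV_additive R n (fun x => x *m A) (measurable_linear A).
have {}hE (E : set 'rV[R]_n) : measurable E ->
    lebesgue_rV n ((fun x => x *m A) @^-1` E) =
    (lebesgue_rV n ((fun x => x *m A) @^-1` @unit_cube n) * lebesgue_rV n E)%E.
  move=> mE; rewrite hE ?lebesgue_rV_unit_cube ?mule1//.
  - by move=> x y /=; rewrite mulmxBl.
  - by move=> x; exists (x *m invmx A); rewrite mulmxKV.
  - exact: measurable_unit_cube.
have fink : lebesgue_rV n ((fun x => x *m A) @^-1` @unit_cube n) \is a fin_num.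
  pose M := \sum_i \sum_j `|invmx A i j|.
  rewrite ge0_fin_numE//.
  apply: (@le_lt_trans _ _ (lebesgue_rV n [set x : 'rV[R]_n |
     forall i, `[- M, M]%classic (x ord0 i : measurableTypeR R)])).
    apply: le_measure; rewrite ?inE.
    - rewrite -[X in measurable X]setTI; apply: measurable_linear => //.
      exact: measurable_unit_cube.
    - exact: (@measurable_box R n (fun=> `[- M, M]%classic)).
    - move=> x /= Qx i; rewrite in_itv/= -ler_norml -(mulmxK uA x) mxE.
      apply: le_trans (ler_norm_sum _ _ _) _.
      apply: ler_sum => j _; rewrite normrM.
      apply: (@le_trans _ _ `|invmx A j i|).
        rewrite -[leRHS]mul1r ler_wpM2r//.
        by have := Qx j; rewrite /= in_itv/= => /andP[? ?]; rewrite ger0_norm.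
      by rewrite (bigD1 i)//= lerDl sumr_ge0.
  rewrite (@lebesgue_rV_box R n (fun=> `[- M, M]%classic))//.
  rewrite -ge0_fin_numE ?prode_ge0//.
  apply/prode_fin_num => i _.
  by rewrite lebesgue_measure_itv/=; case: ifP.
have k0 : 0 <= fine (lebesgue_rV n ((fun x => x *m A) @^-1` @unit_cube n)).
  exact/fine_ge0/measure_ge0.
by exists (NngNum k0) => E mE /=; rewrite fineK// hE.
Qed.

End linear_maps.

(** * Cubes and the Vitali covering argument *)

Section cubes.
Context {R : realType} (n : nat).
Implicit Types (z y : 'rV[R]_n) (r t : R).
Notation leb := (lebesgue_rV n : {sigma_finite_measure set 'rV[R]_n -> \bar R}).

Definition open_cube z r : set 'rV[R]_n :=
  [set y | forall i, `|y ord0 i - z ord0 i| < r].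

(** Half-open, like a difference of two closed half-lines. *)
Definition half_open_cube z t : set 'rV[R]_n :=
  [set y | forall i, - (t / 2) <= y ord0 i - z ord0 i < t / 2].

Let open_cubeE z r : open_cube z r =
  [set y | forall i, `]z ord0 i - r, z ord0 i + r[%classic (y ord0 i)].
Proof.
apply/seteqP; split=> y yz i; have := yz i => /=.
  by rewrite ltr_norml in_itv/= => /andP[? ?]; apply/andP; split; lra.
by rewrite ltr_norml in_itv/= => /andP[? ?]; apply/andP; split; lra.
Qed.

Let half_open_cubeE z t : half_open_cube z t =
  [set y | forall i, `[z ord0 i - t / 2, z ord0 i + t / 2[%classic (y ord0 i)].
Proof.
apply/seteqP; split=> y yz i; have := yz i => /=.
  by rewrite in_itv/= => /andP[? ?]; apply/andP; split; lra.
by rewrite in_itv/= => /andP[? ?]; apply/andP; split; lra.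
Qed.

Lemma measurable_open_cube z r : measurable (open_cube z r).
Proof.
rewrite open_cubeE.
exact: (@measurable_box R n (fun i => `]z ord0 i - r, z ord0 i + r[%classic)).
Qed.

Lemma measurable_half_open_cube z t : measurable (half_open_cube z t).
Proof.
rewrite half_open_cubeE.
exact: (@measurable_box R n (fun i =>
  `[z ord0 i - t / 2, z ord0 i + t / 2[%classic)).
Qed.

Lemma lebesgue_open_cube z r : 0 < r -> leb (open_cube z r) = ((2 * r) ^+ n)%:E.
Proof.
move=> r0; rewrite open_cubeE.
rewrite (@lebesgue_rV_box R n (fun i => `]z ord0 i - r, z ord0 i + r[%classic))//.
rewrite (eq_bigr (fun=> (2 * r)%:E)) => [|i _].
  by rewrite prodEFin prodr_const card_ord.
rewrite lebesgue_measure_itv/= lte_fin ifT; last by lra.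
by rewrite -EFinB; congr EFin; ring.
Qed.

Lemma lebesgue_half_open_cube z t : 0 < t ->
  leb (half_open_cube z t) = (t ^+ n)%:E.
Proof.
move=> t0; rewrite half_open_cubeE.
rewrite (@lebesgue_rV_box R n (fun i =>
  `[z ord0 i - t / 2, z ord0 i + t / 2[%classic))//.
rewrite (eq_bigr (fun=> t%:E)) => [|i _].
  by rewrite prodEFin prodr_const card_ord.
rewrite lebesgue_measure_itv/= lte_fin ifT; last by lra.
by rewrite -EFinB; congr EFin; field.
Qed.

Lemma lebesgue_open_cube_lty z r : (leb (open_cube z r) < +oo)%E.
Proof.
have r'0 : 0 < `|r| + 1 by rewrite ltr_wpDl.
apply: (@le_lt_trans _ _ (leb (open_cube z (`|r| + 1)))).
  apply: le_measure; rewrite ?inE; [exact: measurable_open_cube..|].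
  move=> y yz i; apply: lt_trans (yz i) _.
  by rewrite (le_lt_trans (ler_norm r))// ltrDl.
by rewrite lebesgue_open_cube// ltry.
Qed.

Lemma lebesgue_half_open_cube_lty z t : (leb (half_open_cube z t) < +oo)%E.
Proof.
apply: le_lt_trans (lebesgue_open_cube_lty z (`|t| + 1)).
apply: le_measure; rewrite ?inE;
  [exact: measurable_half_open_cube|exact: measurable_open_cube|].
move=> y yz i; have := yz i => /andP[? ?].
have := ler_norm t; have := ler_norm (- t); rewrite normrN => ? ?.
by rewrite ltr_norml; apply/andP; split; lra.
Qed.

Lemma integrable_indic_lty (A : set 'rV[R]_n) : measurable A ->
  (leb A < +oo)%E -> leb.-integrable setT (EFin \o (\1_A : 'rV[R]_n -> R)).
Proof.
move=> mA Aoo; apply/integrableP; split; first exact/measurable_EFinP.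
under eq_integral => y _ do rewrite /= ger0_norm ?ler0n//.
by rewrite integral_indic// setIT.
Qed.

(** The geometric core of the covering argument: a cube that meets a larger one
    lies in its threefold dilation. *)
Lemma open_cube_sub3 z r z' r' : r' <= r ->
  open_cube z r `&` open_cube z' r' !=set0 ->
    open_cube z' r' `<=` open_cube z (3 * r).
Proof.
move=> r'r [w [wz wz']] y yz' i.
have := wz i; have := wz' i; have := yz' i.
by rewrite !ltr_norml => /andP[? ?] /andP[? ?] /andP[? ?]; apply/andP; split; lra.
Qed.

Lemma seq_argmax (T : eqType) (f : T -> R) (s : seq T) : s != [::] ->
  exists2 p, p \in s & forall q, q \in s -> f q <= f p.
Proof.
elim: s => // a s ih _; have [->|s0] := eqVneq s [::].
  by exists a; rewrite ?mem_head// => q; rewrite inE => /eqP ->.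
have [p ps pmax] := ih s0; have [ap|pa] := leP (f a) (f p).
  exists p; first by rewrite inE ps orbT.
  by move=> q; rewrite inE => /predU1P[->//|/pmax].
exists a; first exact: mem_head.
move=> q; rewrite inE => /predU1P[->//|/pmax qp].
exact: le_trans qp (ltW pa).
Qed.

Definition cubes (s : seq ('rV[R]_n * R)) : set 'rV[R]_n :=
  \bigcup_(p in [set` s]) open_cube p.1 p.2.

Lemma measurable_cubes s : measurable (cubes s).
Proof.
apply: fin_bigcup_measurable => //.
by move=> p _; exact: measurable_open_cube.
Qed.

(** Vitali covering argument, by induction on the family: keep the largest
    cube C, discard those that meet it, which the threefold dilation of C
    covers, and apply the induction hypothesis to the others, whose union is
    disjoint from C. *)
Lemma vitali_cubes (nu : set 'rV[R]_n -> \bar R) (K : R) (s : seq ('rV[R]_n * R)) :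
  0 <= K ->
  (forall A, 0 <= nu A)%E ->
  (forall A B, measurable A -> measurable B -> A `<=` B -> (nu A <= nu B)%E) ->
  (forall A B, measurable A -> measurable B -> A `&` B = set0 ->
     (nu (A `|` B) = nu A + nu B)%E) ->
  (forall p, p \in s -> (0 < p.2)%R /\
     leb (open_cube p.1 (3 * p.2)) <= K%:E * nu (open_cube p.1 p.2))%E ->
  (leb (cubes s) <= K%:E * nu (cubes s))%E.
Proof.
move=> K0 nu0 nuS nuU.
have [m] := ubnP (size s); elim: m s => // m ih s /ltnSE sm sK.
have [->|sN0] := eqVneq s [::].
  rewrite (_ : cubes [::] = set0) ?measure0 ?mule_ge0//.
  by apply/seteqP; split => // x [].
have [p ps pmax] := seq_argmax snd sN0.
pose C := open_cube p.1 p.2; have mC : measurable C by exact: measurable_open_cube.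
pose D q := `[< C `&` open_cube q.1 q.2 = set0 >].
pose s' := [seq q <- s | D q].
have ss' : {subset s' <= s} by move=> q; rewrite mem_filter => /andP[].
have {}ih : (leb (cubes s') <= K%:E * nu (cubes s'))%E.
  apply: ih => [|q qs']; last by apply: sK; exact: ss'.
  apply: leq_trans sm; rewrite /s' -(count_predC D s) size_filter.
  rewrite -[X in (X < _)%N]addn0 ltn_add2l -has_count.
  apply/hasP; exists p => //=; apply/asboolP => /eqP; rewrite setIid => /eqP.
  apply/eqP/set0P; exists p.1 => i /=; rewrite subrr normr0.
  by case: (sK _ ps).
have Cs' : C `&` cubes s' = set0.
  apply/seteqP; split => // x [Cx [q /=]];
    rewrite mem_filter => /andP[/asboolP Dq _] qx.
  by have : (C `&` open_cube q.1 q.2) x by []; rewrite Dq.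
have cov : cubes s `<=` open_cube p.1 (3 * p.2) `|` cubes s'.
  move=> x [q /= qs qx]; have [Dq|/asboolP Dq] := boolP (D q).
    by right; exists q => //=; rewrite mem_filter Dq.
  by left; apply: (open_cube_sub3 (pmax _ qs) _ qx); exact/set0P/eqP.
have mcs' := measurable_cubes s'; have mcs := measurable_cubes s.
have mC3 := measurable_open_cube p.1 (3 * p.2).
apply: (@le_trans _ _ (leb (open_cube p.1 (3 * p.2)) + leb (cubes s'))%E).
  apply: le_trans (measureU2 _ _ _) => //.
  by apply: le_measure; rewrite ?inE//; exact: measurableU.
apply: (@le_trans _ _ (K%:E * nu (C `|` cubes s'))%E).
  rewrite nuU//.
  rewrite ge0_muleDr//; apply: leeD => //.
  by have [_] := sK _ ps.
rewrite lee_wpmul2l// nuS//; first exact: measurableU.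
move=> x [Cx|[q /= qs qx]]; first by exists p.
by exists q => //=; exact: ss'.
Qed.

End cubes.

(** * The Hardy-Littlewood maximal inequality *)

Section cube_maximal_inequality.
Context {R : realType} (n : nat).
Notation leb := (lebesgue_rV n : {sigma_finite_measure set 'rV[R]_n -> \bar R}).
Implicit Types (h phi : 'rV[R]_n -> R) (z : 'rV[R]_n) (t : R).

Definition cube_average h t z : R :=
  (`|t| ^+ n)^-1 * \int[leb]_(y in half_open_cube z `|t|) h y.

(** Cubes with rational centre and radius suffice to detect averages, which
    makes the coverings below countable. *)
Lemma rational_cube z t : 0 < t -> exists (q : 'rV[rat]_n) (r : rat),
  [/\ 0 < ratr r :> R, ratr r <= t :> R,
      open_cube (map_mx ratr q) (ratr r) z &
      half_open_cube z t `<=` open_cube (map_mx ratr q) (ratr r : R)].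
Proof.
move=> t0.
have [r] : exists r, ratr r \in `]3 / 4 * t, t[ by apply: rat_in_itvoo; lra.
rewrite in_itv/= => /andP[tr rt].
have hq i : exists q, ratr q \in `]z ord0 i - t / 4, z ord0 i + t / 4[.
  by apply: rat_in_itvoo; lra.
have [q qP] := choice hq.
have {}qP i : `|ratr (q i) - z ord0 i| < t / 4.
  by have := qP i; rewrite in_itv/= ltr_norml => /andP[? ?]; apply/andP; split; lra.
exists (\row_i q i), r; split; [lra|exact: ltW| |].
  by move=> i; rewrite !mxE distrC; apply: lt_trans (qP i) _; lra.
move=> y yz i; rewrite !mxE.
have := yz i; have := qP i; rewrite !ltr_norml => /andP[? ?] /andP[? ?].
by apply/andP; split; lra.
Qed.

(** If the average of phi over a cube centred at z exceeds e in absolute value,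
    that cube lies in a rational cube of radius at most its side that contains
    z. So U can be the union of the countably many rational cubes on which the
    integral of |phi| is large; the covering argument bounds the measure of
    finite subunions, hence of U. *)
Lemma cube_maximal_inequality phi (e : R) : L1 phi -> 0 < e ->
  exists U, [/\ measurable U,
    (leb U <= (6 ^+ n / e)%:E * \int[leb]_y `|phi y|%:E)%E &
    forall z t, t != 0 -> ~ U z -> `|cube_average phi t z| <= e].
Proof.
move=> iphi e0.
have mphi : measurable_fun setT (fun y => `|phi y|%:E).
  apply/measurable_EFinP; apply: measurableT_comp => //.
  by apply/measurable_EFinP; case/integrableP: iphi.
pose nu A := (\int[leb]_(y in A) `|phi y|%:E)%E.
pose bad (p : 'rV[R]_n * R) := 0 < p.2 /\ ((e * p.2 ^+ n)%:E <= nu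
  (open_cube p.1 p.2))%E.
pose pt (i : 'rV[rat]_n * rat) : 'rV[R]_n * R := (map_mx ratr i.1, ratr i.2).
pose s k := [seq p <- [seq pt i | i <- pmap unpickle (iota 0 k)] | `[< bad p >]].
pose U := \bigcup_k cubes (s k).
have mU : measurable U by apply: bigcupT_measurable => k; exact: measurable_cubes.
have nuS (A B : set 'rV[R]_n) :
  measurable A -> measurable B -> A `<=` B -> (nu A <= nu B)%E.
  move=> mA mB AB; apply: ge0_subset_integral => //; exact: measurable_funTS.
exists U; split => //.
  have sK k : (leb (cubes (s k)) <= (6 ^+ n / e)%:E * \int[leb]_y `|phi y|%:E)%E.
    apply: (@le_trans _ _ ((6 ^+ n / e)%:E * nu (cubes (s k))))%E; last first.
      rewrite lee_wpmul2l ?lee_fin ?divr_ge0 ?exprn_ge0 ?(ltW e0)//.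
      by apply: nuS => //; exact: measurable_cubes.
    apply: vitali_cubes => //.
    - by rewrite divr_ge0 ?exprn_ge0 ?(ltW e0).
    - by move=> A; apply: integral_ge0 => x _; rewrite lee_fin.
    - move=> A B mA mB AB0; rewrite /nu ge0_integral_setU//.
      + exact: measurable_funTS.
      + exact/disj_set2P.
    - move=> p; rewrite mem_filter => /andP[/asboolP[p0 bp] _]; split => //.
      rewrite lebesgue_open_cube ?mulr_gt0//.
      apply: (@le_trans _ _ ((6 ^+ n / e)%:E * (e * p.2 ^+ n)%:E)%E).
        rewrite -EFinM lee_fin (mulrA 2) -natrM exprMn.
        by rewrite (mulrA (_ / e)) mulfVK ?gt_eqF.
      by rewrite lee_wpmul2l// lee_fin divr_ge0 ?exprn_ge0 ?(ltW e0).
  (* Continuity from below transfers the bound from finite unions to U. *)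
  have cvU : leb \o (fun k => cubes (s k)) @ \oo --> leb U.
    apply: nondecreasing_cvg_mu => //; first by move=> k; exact: measurable_cubes.
    move=> k l kl; apply/subsetPset => x [p /= ps px]; exists p => //=.
    move: ps; rewrite !mem_filter => /andP[-> /=] /mapP[i ik ->].
    apply: map_f; move: ik; rewrite !mem_pmap => /mapP[j jk ->].
    apply: map_f; move: jk; rewrite !mem_iota !add0n => /andP[_ jk].
    exact: leq_trans jk kl.
  by rewrite -(cvg_lim _ cvU)//; apply: lime_le; [by apply/cvg_ex;
    exists (leb U)|exact: nearW].
move=> z t t0 Uz; rewrite leNgt; apply/negP => et; apply: Uz.
have t'0 : 0 < `|t| by rewrite normr_gt0.
have [q [r [r0 rt qz hz]]] := rational_cube z t'0.
have badp : bad (pt (q, r)).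
  split => //=; apply: (@le_trans _ _ (nu (half_open_cube z `|t|))); last first.
    apply: nuS => //; [exact: measurable_half_open_cube|exact:
      measurable_open_cube].
  apply: (@le_trans _ _ (e * `|t| ^+ n)%:E).
    by rewrite lee_fin ler_wpM2l ?(ltW e0)// lerXn2r ?nnegrE ?(ltW r0).
  have mh : measurable (half_open_cube z `|t|) by exact: measurable_half_open_cube.
  have ih : leb.-integrable (half_open_cube z `|t|) (EFin \o phi).
    exact: (integrableS _ _ _ iphi).
  apply: (@le_trans _ _ (`|\int[leb]_(y in half_open_cube z `|t|) phi y|)%:E).
    rewrite lee_fin -ler_pdivlMr ?exprn_gt0// mulrC.
    move: et; rewrite /cube_average normrM ger0_norm ?invr_ge0 ?exprn_ge0//.
    exact: ltW.
  rewrite EFin_normr_Rintegral//.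
  exact: le_abse_integral (measurable_int _ ih).
pose i := (q, r).
suff : pt i \in s (pickle i).+1 by exists (pickle i).+1 => //; exists (pt i).
rewrite mem_filter (asboolT badp) andTb; apply: map_f.
rewrite mem_pmap; apply/mapP; exists (pickle i); last by rewrite pickleK.
by rewrite mem_iota add0n ltnSn.
Qed.

End cube_maximal_inequality.

(** * Averages over shrinking cubes *)

Section cube_averages.
Context {R : realType} (n : nat).
Notation leb := (lebesgue_rV n : {sigma_finite_measure set 'rV[R]_n -> \bar R}).
Implicit Types (h k : 'rV[R]_n -> R) (z : 'rV[R]_n) (t : R).

Lemma mx_norm_le_coord (x : 'rV[R]_n) (r : R) : 0 <= r ->
  (forall i, `|x ord0 i| <= r) -> `|x| <= r.
Proof.
move=> r0 xr; rewrite [leLHS]mx_normrE; apply: bigmax_le => // -[i j] _ /=.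
by rewrite (ord1 i).
Qed.

Lemma near_half_open_cube z (P : set 'rV[R]_n) : nbhs z P ->
  \forall t \near (0 : R)^', half_open_cube z `|t| `<=` P.
Proof.
case/nbhs_ballP => e /= e0 eP.
near=> t => y yz; apply: eP; rewrite mx_norm_ball /ball_/=.
apply: (@le_lt_trans _ _ `|t|).
  apply: mx_norm_le_coord => // i; rewrite !mxE distrC.
  have := yz i; have := normr_ge0 t.
  by move=> t0 /andP[? ?]; rewrite ler_norml; apply/andP; split; lra.
near: t; apply: dnbhs0_lt => //.
Unshelve. all: by end_near.
Qed.

Lemma cube_average_eq_near h k z : (\forall y \near z, h y = k y) ->
  \forall t \near (0 : R)^', cube_average h t z = cube_average k t z.
Proof.
move=> /near_half_open_cube; apply: filterS => t hk.
congr (_ * _); apply: eq_Rintegral => y; rewrite inE => /hk //.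
Qed.

Lemma cube_average_cst (c : R) z : \forall t \near (0 : R)^',
  cube_average (fun=> c) t z = c.
Proof.
near=> t.
have t0 : 0 < `|t|.
  by rewrite normr_gt0; near: t; exact: nbhs_dnbhs_neq.
rewrite /cube_average Rintegral_cst; last exact: measurable_half_open_cube.
rewrite [X in fine X](lebesgue_half_open_cube z t0).
by rewrite /= mulrCA mulVf ?mulr1// expf_neq0 ?gt_eqF.
Unshelve. all: by end_near.
Qed.

Definition integrable_on_cubes h := forall z t,
  leb.-integrable (half_open_cube z t) (EFin \o h).

Lemma L1_integrable_on_cubes h : L1 h -> integrable_on_cubes h.
Proof.
move=> ih z t; apply: integrableS ih => //; exact: measurable_half_open_cube.
Qed.

Lemma cube_averageB h k t z : integrable_on_cubes h -> integrable_on_cubes k ->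
  cube_average (fun y => h y - k y) t z = cube_average h t z - cube_average k t z.
Proof.
move=> ih ik; rewrite /cube_average RintegralB ?mulrBr//.
exact: measurable_half_open_cube.
Qed.

Lemma cube_averageD h k t z : integrable_on_cubes h -> integrable_on_cubes k ->
  cube_average (fun y => h y + k y) t z = cube_average h t z + cube_average k t z.
Proof.
move=> ih ik; rewrite /cube_average RintegralD ?mulrDr//.
exact: measurable_half_open_cube.
Qed.

Lemma cube_averageZ (c : R) h t z : integrable_on_cubes h ->
  cube_average (fun y => c * h y) t z = c * cube_average h t z.
Proof.
move=> ih; rewrite /cube_average RintegralZl ?(mulrCA _ c)//.
exact: measurable_half_open_cube.
Qed.

Definition differentiable_by_cubes h :=
  {ae leb, forall z, cube_average h t z @[t --> (0 : R)^'] --> h z}.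

Lemma integrable_on_cubesD h k : integrable_on_cubes h -> integrable_on_cubes k ->
  integrable_on_cubes (fun y => h y + k y).
Proof.
move=> ih ik z t.
have := integrableD (measurable_half_open_cube z t) (ih z t) (ik z t).
by apply: eq_integrable => //; exact: measurable_half_open_cube.
Qed.

Lemma integrable_on_cubesZ (c : R) h : integrable_on_cubes h ->
  integrable_on_cubes (fun y => c * h y).
Proof.
move=> ih z t.
have := integrableZl (measurable_half_open_cube z t) c (ih z t).
by apply: eq_integrable => //; exact: measurable_half_open_cube.
Qed.

Lemma differentiable_by_cubesB h k :
  integrable_on_cubes h -> integrable_on_cubes k ->
  differentiable_by_cubes h -> differentiable_by_cubes k ->
  differentiable_by_cubes (fun y => h y - k y).
Proof.
move=> ih ik; apply: filterS2 => z hz kz.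
under eq_fun do rewrite cube_averageB//.
exact: cvgB.
Qed.

Lemma differentiable_by_cubesD h k :
  integrable_on_cubes h -> integrable_on_cubes k ->
  differentiable_by_cubes h -> differentiable_by_cubes k ->
  differentiable_by_cubes (fun y => h y + k y).
Proof.
move=> ih ik; apply: filterS2 => z hz kz.
under eq_fun do rewrite cube_averageD//.
exact: cvgD.
Qed.

Lemma differentiable_by_cubesZ (c : R) h : integrable_on_cubes h ->
  differentiable_by_cubes h -> differentiable_by_cubes (fun y => c * h y).
Proof.
move=> ih; apply: filterS => z hz.
under eq_fun do rewrite cube_averageZ//.
exact: cvgMr.
Qed.

(** Stated for arbitrary sets, so that it applies to the set of points where a
    limit fails. *)
Lemma negligible_le_small (A : set 'rV[R]_n) :
  (forall d : R, 0 < d ->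
     exists V, [/\ measurable V, A `<=` V & (leb V <= d%:E)%E]) ->
  leb.-negligible A.
Proof.
move=> H.
have H' j : exists V, [/\ measurable V, A `<=` V & (leb V <= (j.+1%:R^-1)%:E)%E].
  exact: H.
have [V VP] := choice H'.
exists (\bigcap_j V j); split.
- by apply: bigcapT_measurable => j; case: (VP j).
- apply/eqP; rewrite -measure_le0; apply/lee_addgt0Pr => e e0; rewrite add0e.
  have [j] := ltr_add_invr e0.
  rewrite add0r => /ltW je.
  have [mV _ Vj] := VP j.
  apply: le_trans (le_trans Vj _); last by rewrite lee_fin.
  apply: le_measure; rewrite ?inE//; last exact: bigcap_inf.
  by apply: bigcapT_measurable => i; case: (VP i).
- by move=> x Ax j _; case: (VP j) => _ AV _; exact: AV.
Qed.

(** Being the almost everywhere limit of one's averages is a closed condition in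
    L1. Approximate h by k: the averages of h differ from those of k by averages
    of h - k, which the maximal inequality controls off a small set, while
    Markov's inequality controls h - k itself. *)
Lemma differentiable_by_cubes_closed h : integrable_on_cubes h ->
  (forall d : R, 0 < d -> exists k, [/\ integrable_on_cubes k,
     differentiable_by_cubes k, L1 (fun y => h y - k y) &
     (\int[leb]_y `|h y - k y|%:E <= d%:E)%E]) ->
  differentiable_by_cubes h.
Proof.
move=> ih H.
suff D (e : R) : 0 < e -> {ae leb, forall z, \forall t \near (0 : R)^',
    `|h z - cube_average h t z| <= 3 * e}.
  have /ae_foralln : forall m : nat, {ae leb, forall z, \forall t \near (0 : R)^',
      `|h z - cube_average h t z| <= 3 * (3 * m.+1%:R)^-1}.
    by move=> m; apply: D.
  apply: filterS => z hz; apply/cvgrPdist_le => e e0.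
  have [m] := ltr_add_invr e0.
  rewrite add0r => /ltW me; have := hz m; apply: filterS => t /le_trans; apply.
  by rewrite invfM mulrA divff// mul1r.
move=> e0; apply: negligible_le_small => d d0.
pose d' := d / (6 ^+ n / e + e^-1).
have c0 : 0 < 6 ^+ n / e + e^-1.
  by rewrite addr_gt0 ?divr_gt0 ?exprn_gt0 ?invr_gt0.
have d'0 : 0 < d' by rewrite divr_gt0.
have [k [ik dk ihk hkd]] := H _ d'0.
have [U [mU leU hU]] := cube_maximal_inequality ihk e0.
have [N [mN N0 kN]] := dk.
have [mhk _] := integrableP _ _ _ ihk.
pose W := [set y | (e%:E <= `|(h y - k y)%:E|)%E].
have mW : measurable W.
  rewrite -[W]setTI; apply: emeasurable_fun_c_infty => //.
  exact: measurableT_comp.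
exists (N `|` U `|` W); split.
- by apply: measurableU => //; exact: measurableU.
- move=> z /= nz; apply: contrapT => /not_orP[/not_orP[Nz Uz] Wz]; apply: nz.
  have kz : cube_average k t z @[t --> (0 : R)^'] --> k z.
    by apply: contrapT => kz; exact/Nz/kN.
  move/cvgrPdist_le : kz => /(_ _ e0) kz.
  have t0 : \forall t \near (0 : R)^', t != 0 by exact: nbhs_dnbhs_neq.
  apply: filterS2 kz t0 => t kt t0.
  have {}hU := hU z t t0 Uz; rewrite cube_averageB// in hU.
  move/negP: Wz; rewrite /= lee_fin -ltNge => Wz.
  (* Three terms, each at most e off the exceptional set. *)
  rewrite (_ : h z - _ = (h z - k z) + (k z - cube_average k t z) -
    (cube_average h t z - cube_average k t z)); last by ring.
  apply: le_trans (ler_normB _ _) _;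
    apply: le_trans (lerD (ler_normD _ _) (lexx _)) _.
  lra.
- apply: le_trans (measureU2 _ _ _) _ => //; first exact: measurableU.
  apply: (@le_trans _ _ ((6 ^+ n / e)%:E * d'%:E + (e^-1)%:E * d'%:E)%E).
    apply: leeD.
      apply: le_trans (measureU2 _ _ _) _ => //.
      rewrite [X in (X + _)%E](_ : _ = 0%E)// add0e; apply: le_trans leU _.
      by rewrite lee_wpmul2l// lee_fin divr_ge0 ?exprn_ge0 ?(ltW e0).
    have := le_integral_abse leb measurableT mhk e0; rewrite setTI => le.
    rewrite -lee_pdivrMl ?invr_gt0// invrK; apply: le_trans hkd;
      apply: le_trans le _.
    by under eq_integral do rewrite abse_EFin.
  by rewrite -!EFinM -EFinD -mulrDl lee_fin /d' mulrC mulfVK// gt_eqF.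
Qed.

End cube_averages.

(** * The Lebesgue differentiation theorem for cubes *)

Section lebesgue_differentiation_cubes.
Context {R : realType} (n : nat).
Notation leb := (lebesgue_rV n : {sigma_finite_measure set 'rV[R]_n -> \bar R}).
Implicit Types (h k : 'rV[R]_n -> R) (z : 'rV[R]_n) (t : R) (E : set 'rV[R]_n).

(** Measurable sets with a negligible boundary. They form a pi-system that
    generates the sigma-algebra, and their indicators are constant near almost
    every point: this is the starting point of a Dynkin induction. *)
Definition null_boundary : set (set 'rV[R]_n) :=
  [set E | measurable E /\ {ae leb, forall z,
    (\forall y \near z, E y) \/ (\forall y \near z, ~ E y)}].

Lemma null_boundaryI : setI_closed null_boundary.
Proof.
move=> A B [mA nA] [mB nB]; split; first exact: measurableI.
apply: filterS2 nA nB => z [Az|Az] [Bz|Bz].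
- by left; apply: filterS2 Az Bz.
- by right; apply: filterS Bz => y By [].
- by right; apply: filterS Az => y By [].
- by right; apply: filterS Az => y By [].
Qed.

Lemma coord_near z (i : 'I_n) (P : set R) : nbhs (z ord0 i) P ->
  \forall y \near z, P ((y : 'rV[R]_n) ord0 i).
Proof. by move=> Pz; exact: (@coord_continuous R 1 n ord0 i z _ Pz). Qed.

Lemma null_boundary_halfspace (i : 'I_n) (a : R) :
  null_boundary [set y | y ord0 i < a].
Proof.
split.
  have := @measurable_coor R n i measurableT _ (measurable_itv `]-oo, a[).
  by rewrite setTI; congr measurable; apply/seteqP; split => y /=; rewrite in_itv.
exists [set y : 'rV[R]_n | y ord0 i = a]; split.
- exact: measurable_hyperplane.
- exact: lebesgue_rV_hyperplane.
- move=> z /= nz; apply: contrapT => za; apply: nz.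
  have [za'|az|//] := ltgtP (z ord0 i) a.
    by left; exact/(coord_near (P := [set b | b < a]))/lt_nbhsl.
  right; apply: (coord_near (P := [set b | ~ b < a])).
  by apply: filterS (lt_nbhsr az) => b ab; apply/negP; rewrite -leNgt ltW.
Qed.

Lemma measurable_null_boundary :
  @measurable _ 'rV[R]_n = <<s null_boundary >>.
Proof.
apply/seteqP; split; last first.
  by apply: smallest_sub; [exact: sigma_algebra_measurable|move=> E []].
apply: smallest_sub; first exact: smallest_sigma_algebra.
move=> A; rewrite -bigcup_seq/= => -[i _ [B mB <-]].
have mi : measurable_fun setT
    (fun x : g_sigma_algebraType null_boundary => x ord0 i : measurableTypeR R).
  apply: (measurability _ (RGenInftyO.measurableE R)) => //.
  move=> _ [_ [a ->] <-]; rewrite setTI; apply: sub_sigma_algebra.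
  have := null_boundary_halfspace i a.
  by congr null_boundary; apply/seteqP; split => y /=; rewrite in_itv.
exact: mi.
Qed.

Lemma indic_integrable_on_cubes E : measurable E ->
  integrable_on_cubes (\1_E : 'rV[R]_n -> R).
Proof.
move=> mE z t; apply: measurable_bounded_integrable.
- exact: measurable_half_open_cube.
- exact: lebesgue_half_open_cube_lty.
- apply: measurable_funTS; exact: measurable_indic.
- exists 1; split => // x x1 y _ /=; rewrite indicE.
  by case: (_ \in _); rewrite ?normr1 ?normr0 ltW// (lt_trans _ x1).
Qed.

Lemma indic_null_boundary E : null_boundary E ->
  differentiable_by_cubes (\1_E : 'rV[R]_n -> R).
Proof.
case=> mE; apply: filterS => z zE.
have [c cz] : exists c, \forall y \near z, \1_E y = c :> R.
  case: zE => zE; [exists 1|exists 0]; apply: filterS zE => y Ey.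
    by rewrite indicE mem_set.
  by rewrite indicE memNset.
rewrite (nbhs_singleton cz); apply: cvg_near_cst.
by apply: filterS2 (cube_average_eq_near cz) (cube_average_cst c z) => t ->.
Qed.

(** Exhausting balls of the sup norm: they localize functions that are not
    integrable on the whole space, such as indicators. *)
Let B (k : nat) : set 'rV[R]_n := open_cube 0 k%:R.

Lemma open_cube_near z w (r : R) : open_cube z r w ->
  \forall y \near w, open_cube z r y.
Proof.
move=> wz.
suff : \forall y \near w, forall i, `|(y : 'rV[R]_n) ord0 i - z ord0 i| < r by [].
refine (@filter_forall _ _ (fun i (y :
  'rV[R]_n) => `|y ord0 i - z ord0 i| < r) (nbhs w) _ _) => i.
apply: (coord_near (P := [set b | `|b - z ord0 i| < r])).
have : `|b - z ord0 i| @[b --> w ord0 i] --> `|w ord0 i - z ord0 i|.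
  by apply: cvg_norm; apply: cvgB => //; exact: cvg_cst.
by move/cvgr_lt; apply.
Qed.

Lemma null_boundary_ball (k : nat) : null_boundary (B k).
Proof.
split; first exact: measurable_open_cube.
have : {ae leb, forall z : 'rV[R]_n, forall i, `|z ord0 i| != k%:R}.
  apply: filter_forall => i.
  have ne (a : R) : {ae leb, forall z : 'rV[R]_n, z ord0 i != a}.
    exists [set y : 'rV[R]_n | y ord0 i = a]; split.
    - exact: measurable_hyperplane.
    - exact: lebesgue_rV_hyperplane.
    - by move=> z /= /negP/negPn/eqP.
  apply: filterS2 (ne k%:R) (ne (- k%:R)) => z z1 z2 /=.
  by rewrite eqr_norml negb_and negb_or z1 z2.
apply: filterS => z zk.
have [|/existsNP[i]] := pselect (B k z); first by left; exact: open_cube_near.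
move=> /negP; rewrite mxE subr0 -leNgt le_eqVlt eq_sym (negbTE (zk _))/= => ki.
right.
have : \forall y \near z, k%:R < `|(y : 'rV[R]_n) ord0 i|.
  apply: (coord_near (P := [set b | k%:R < `|b|])).
  have : `|b| @[b --> z ord0 i] --> `|z ord0 i| by exact: cvg_norm.
  by move/cvgr_gt; apply.
apply: filterS => y ky /(_ i); rewrite mxE subr0 => yk.
by move: (lt_trans ky yk); rewrite ltxx.
Qed.

(** Averages over small cubes only see h near the point. *)
Lemma differentiable_by_cubes_local h :
  (forall m : nat, differentiable_by_cubes (fun y => \1_(B m) y * h y)) ->
  differentiable_by_cubes h.
Proof.
move=> /ae_foralln; apply: filterS => z hz.
pose m := (Num.truncn `|z|).+1.
have Bz : B m z.
  move=> i; rewrite mxE subr0.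
  exact: le_lt_trans (ler_coord_norm z i) (truncnS_gt _).
have hB : \forall y \near z, \1_(B m) y * h y = h y.
  by apply: filterS (open_cube_near Bz) => y By; rewrite indicE mem_set// mul1r.
have := hz m; rewrite (nbhs_singleton hB); apply: cvg_trans.
apply: near_eq_cvg; exact: cube_average_eq_near hB.
Qed.

Let indic_disjointU (A C D : set 'rV[R]_n) : A `&` C = set0 ->
  \1_((A `|` C) `&` D) = (fun y =>
    \1_(A `&` D) y + \1_(C `&` D) y) :> ('rV[R]_n -> R).
Proof.
move=> AC0; apply/funext => y; rewrite !indicE !in_setI in_setU.
have : ~ (A `&` C) y by rewrite AC0.
have [yA|yA] := boolP (y \in A); have [yC|yC] := boolP (y \in C); rewrite /=.
- by case; split; exact/set_mem.
- by rewrite addr0.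
- by rewrite add0r.
- by rewrite addr0.
Qed.

(** The only step of the Dynkin induction that needs a limit: inside a ball, the
    indicators of the partial unions converge in L1. *)
Let indic_bigcup_step (m : nat) (F : (set 'rV[R]_n)^nat) :
  (forall i, measurable (F i)) -> trivIset setT F ->
  (forall i, differentiable_by_cubes (\1_(F i `&` B m) : 'rV[R]_n -> R)) ->
  differentiable_by_cubes (\1_(\bigcup_i F i `&` B m) : 'rV[R]_n -> R).
Proof.
move=> mF tF dF.
have mB : measurable (B m) by exact: measurable_open_cube.
pose G N := \big[setU/set0]_(i < N) F i.
have mG N : measurable (G N) by exact: bigsetU_measurable.
have mGB N : measurable (G N `&` B m) by exact: measurableI.
have mU : measurable (\bigcup_i F i) by exact: bigcupT_measurable.
have mUB : measurable (\bigcup_i F i `&` B m) by exact: measurableI.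
have dG N : differentiable_by_cubes (\1_(G N `&` B m) : 'rV[R]_n -> R).
  elim: N => [|N ih].
    apply: indic_null_boundary; rewrite /G big_ord0 set0I; split => //.
    by apply: aeW => z; right; apply: (@filterE _ (nbhs z)) => y [].
  rewrite /G big_ord_recr/= -/(G N) indic_disjointU.
    apply: differentiable_by_cubesD => //; apply: indic_integrable_on_cubes => //.
    exact: measurableI.
  apply/seteqP; split => // y [GNy FNy].
  move: GNy; rewrite /G -bigcup_mkord => -[i /= iN Fiy].
  have FiN : F i `&` F N = set0 by move/trivIsetP: tF; apply; rewrite // ltn_eqF.
  by have : (F i `&` F N) y by []; rewrite FiN.
have iB : leb.-integrable setT (EFin \o (\1_(B m) : 'rV[R]_n -> R)).
  by apply: integrable_indic_lty => //; exact: lebesgue_open_cube_lty.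
pose f_ N := EFin \o (\1_(G N `&` B m) : 'rV[R]_n -> R).
pose f := EFin \o (\1_(\bigcup_i F i `&` B m) : 'rV[R]_n -> R).
have mf_ N : measurable_fun setT (f_ N).
  by apply/measurable_EFinP; exact: measurable_indic.
have mf : measurable_fun setT f.
  by apply/measurable_EFinP; exact: measurable_indic.
have [_ dom _] : [/\ leb.-integrable setT f,
    [sequence (\int[leb]_x `|f_ N x - f x|)%E]_N @ \oo --> 0%E &
    [sequence (\int[leb]_x f_ N x)%E]_N @ \oo --> (\int[leb]_x f x)%E].
  apply: (dominated_convergence measurableT mf_ mf _ iB).
  - apply: aeW => y _; apply: cvg_near_cst.
    have [[j _ Fjy]|nFy] := pselect ((\bigcup_i F i) y).
      exists j.+1 => // N /= jN; rewrite /f_ /f /= !indicE !in_setI.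
      rewrite (mem_set (_ : (\bigcup_i F i) y)); last by exists j.
      by rewrite (mem_set (_ : G N y))// /G -bigcup_mkord; exists j.
    exists 0%N => // N _; rewrite /f_ /f /= !indicE !in_setI.
    rewrite (memNset nFy) memNset// /G -bigcup_mkord => -[j /= _ Fjy].
    by apply: nFy; exists j.
  - apply: aeW => y N _; rewrite /f_ /= lee_fin !indicE in_setI.
    by case: (_ \in _); case: (_ \in _); rewrite ?normr0 ?normr1.
apply: differentiable_by_cubes_closed => [|d d0].
  exact: indic_integrable_on_cubes.
have [+ /cvgrPdist_le/(_ _ d0)[N _ HN]] := (fine_cvgP _ _).1 dom.
move=> [M _ HM].
exists (\1_(G (maxn M N) `&` B m)); split => //.
- exact: indic_integrable_on_cubes.
- have Boo := lebesgue_open_cube_lty (0 : 'rV[R]_n) m%:R.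
  have sub (A : set 'rV[R]_n) : measurable A -> (leb (A `&` B m) < +oo)%E.
    move=> mA; apply: le_lt_trans Boo; apply: le_measure.
    - by apply/mem_set; exact: measurableI.
    - exact/mem_set.
    - exact: subIsetr.
  have := integrableB measurableT (integrable_indic_lty mUB (sub _ mU))
    (integrable_indic_lty (mGB (maxn M N)) (sub _ (mG _))).
  exact: eq_integrable.
- have := HN _ (leq_maxr M N); rewrite sub0r normrN /= => gd.
  rewrite [leLHS](_ : _ = \int[leb]_x `|f_ (maxn M N) x - f x|)%E; last first.
    by apply: eq_integral => y _; rewrite /f_ /f /= distrC.
  rewrite -[leLHS](fineK (HM _ (leq_maxl M N))) lee_fin.
  exact: le_trans (ler_norm _) gd.
Qed.

Lemma indic_differentiable_by_cubes E : measurable E ->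
  differentiable_by_cubes (\1_E : 'rV[R]_n -> R).
Proof.
rewrite measurable_null_boundary => mE.
suff H (m : nat) : differentiable_by_cubes (\1_(E `&` B m) : 'rV[R]_n -> R).
  apply: differentiable_by_cubes_local => m; have := H m.
  by congr differentiable_by_cubes; apply/funext => y; rewrite indicI mulrC.
pose P E := differentiable_by_cubes (\1_(E `&` B m) : 'rV[R]_n -> R).
have mB : measurable (B m) by exact: measurable_open_cube.
rewrite -/(P E).
apply: (dynkin_induction measurable_null_boundary null_boundaryI) mE => //.
- by rewrite /P setTI; apply: indic_null_boundary; exact: null_boundary_ball.
- move=> A nA; apply: indic_null_boundary; apply: null_boundaryI => //.
  exact: null_boundary_ball.
- move=> A mA PA; rewrite /P.
  rewrite (_ : \1_(~` A `&` B m) = (fun y => \1_(B m) y - \1_(A `&` B m) y)).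
    apply: differentiable_by_cubesB => //.
    + exact: indic_integrable_on_cubes.
    + by apply: indic_integrable_on_cubes; exact: measurableI.
    + by apply: indic_null_boundary; exact: null_boundary_ball.
  apply/funext => y; rewrite !indicE !in_setI in_setC.
  by case: (y \in A); case: (y \in B m); rewrite ?subrr ?subr0.
- by move=> F mF tF PF; apply: indic_bigcup_step.
Qed.

Import HBSimple.

(** Simple functions are finite combinations of indicators of measurable sets,
    and they are dense in L1; the closure property then gives the theorem. *)
Lemma sfun_differentiable_by_cubes (g : {sfun 'rV[R]_n >-> R}) :
  integrable_on_cubes g /\ differentiable_by_cubes g.
Proof.
have mg (a : R) : measurable (g @^-1` [set a]) by exact: measurable_sfunP.
suff H (r : seq R) :
    let h x := \sum_(a <- r) (a * \1_(g @^-1` [set a]) x) in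
    integrable_on_cubes h /\ differentiable_by_cubes h.
  have := H (finmap.enum_fset (fset_set (range g)));
    rewrite /= (_ : (fun x => _) = g)//.
  by apply/funext => x; rewrite [RHS]fimfunE fsbig_finite.
elim: r => [|a r [ih dh]] /=.
  under eq_fun do rewrite big_nil; split.
    move=> z t; apply: (@integrableS _ _ _ _ setT) => //.
      exact: measurable_half_open_cube.
    exact: integrable0.
  apply: aeW => z; apply: cvg_near_cst; exact: (cube_average_cst 0 z).
under eq_fun do rewrite big_cons.
have ii := @indic_integrable_on_cubes _ (mg a).
split.
  by apply: integrable_on_cubesD => //; exact: integrable_on_cubesZ.
apply: differentiable_by_cubesD => //; first exact: integrable_on_cubesZ.
by apply: differentiable_by_cubesZ => //; exact: indic_differentiable_by_cubes.
Qed.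

Theorem lebesgue_differentiation_cubes h : L1 h -> differentiable_by_cubes h.
Proof.
move=> ih.
have [g [ig _ gh]] := approximation_sfun_integrable measurableT ih.
apply: differentiable_by_cubes_closed => [|d d0].
  exact: L1_integrable_on_cubes.
have /fine_cvgP[[M _ HM] /cvgrPdist_le/(_ _ d0)[N _ HN]] := gh.
have [ig' dg'] := sfun_differentiable_by_cubes (g (maxn M N)).
exists (g (maxn M N)); split => //.
  have := integrableB measurableT ih (ig (maxn M N)).
  exact: eq_integrable.
have := HN _ (leq_maxr M N); rewrite sub0r normrN /= => gd.
rewrite -(fineK (HM _ (leq_maxl M N))) lee_fin.
exact: le_trans (ler_norm _) gd.
Qed.

End lebesgue_differentiation_cubes.

(** * Determinants, Gram matrices and angles *)

Section euclidean_facts.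
Context {R : realType} (n : nat).
Implicit Types x y : 'rV[R]_n.

Lemma dotpE x y : dotp x y = (x *m y^T) ord0 ord0.
Proof. by rewrite mxE; apply: eq_bigr => i _; rewrite mxE. Qed.

Lemma dotpC x y : dotp x y = dotp y x.
Proof. by apply: eq_bigr => i _; rewrite mulrC. Qed.

Lemma dotpBl x y z : dotp (x - y) z = dotp x z - dotp y z.
Proof. by rewrite -sumrB; apply: eq_bigr => i _; rewrite !mxE mulrBl. Qed.

Lemma dotpZl (a : R) x y : dotp (a *: x) y = a * dotp x y.
Proof. by rewrite mulr_sumr; apply: eq_bigr => i _; rewrite mxE mulrA. Qed.

Lemma dotp_ge0 x : 0 <= dotp x x.
Proof. by apply: sumr_ge0 => i _; rewrite -expr2 sqr_ge0. Qed.

Lemma dotp_eq0 x : dotp x x = 0 -> x = 0.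
Proof.
move=> /eqP; rewrite psumr_eq0 => [/allP x0|i _]; last by rewrite -expr2 sqr_ge0.
apply/rowP => i; rewrite mxE; have := x0 i (mem_index_enum _).
by rewrite implyTb mulf_eq0 orbb => /eqP.
Qed.

Lemma sqr_enorm x : enorm x ^+ 2 = dotp x x.
Proof. by rewrite sqr_sqrtr// dotp_ge0. Qed.

Lemma cauchy_schwarz x y : `|dotp x y| <= enorm x * enorm y.
Proof.
rewrite -[leLHS]sqrtr_sqr -sqrtrM ?dotp_ge0//; apply: ler_wsqrtr.
have [y0|y0] := eqVneq y 0.
  have d0 w : dotp w (0 : 'rV[R]_n) = 0.
    by apply: big1 => i _; rewrite mxE mulr0.
  by rewrite y0 !d0 expr0n mulr0.
have yy : 0 < dotp y y.
  by rewrite lt_neqAle dotp_ge0 andbT eq_sym; apply/eqP => /dotp_eq0/eqP;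
    exact/negP.
rewrite -(ler_pM2l yy).
have := dotp_ge0 (dotp y y *: x - dotp x y *: y).
have -> : dotp (dotp y y *: x - dotp x y *: y) (dotp y y *: x - dotp x y *: y) =
    dotp y y * (dotp y y * dotp x x - dotp x y ^+ 2).
  rewrite !(dotpBl, dotpZl) dotpC (dotpC y) !(dotpBl, dotpZl) (dotpC y x).
  by ring.
by rewrite pmulr_rge0// => yx; rewrite ler_pM2l// mulrC -subr_ge0.
Qed.

(** The angle with a hyperplane is defined by complement to pi / 2 and absolute
    value; its sine is the absolute cosine of the angle with the normal. *)
Lemma sin_angle_complement (z : R) : `|z| <= 1 ->
  sin `|pi / 2 - acos z| = `|z|.
Proof.
move=> z1; have z1' : -1 <= z <= 1 by rewrite -ler_norml.
have t0 := acos_ge0 z1'; have tpi := acos_lepi z1'.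
have pi0 := pi_gt0 R.
have w : `|pi / 2 - acos z| <= pi.
  by rewrite ler_norml; apply/andP; split; lra.
have s0 : 0 <= sin `|pi / 2 - acos z| by rewrite sin_ge0_pi// normr_ge0.
apply/eqP; rewrite -(eqrXn2 (n := 2))//; apply/eqP.
rewrite real_normK ?num_real//.
have -> : sin `|pi / 2 - acos z| ^+ 2 = sin (pi / 2 - acos z) ^+ 2.
  by have [_|_] := ger0P (pi / 2 - acos z); rewrite ?sinN ?sqrrN.
by rewrite sinB sin_pihalf cos_pihalf mul0r subr0 mul1r acosK.
Qed.

End euclidean_facts.

Section basis_matrix.
Context {R : realType} (m : nat) (u : 'I_m.+1 -> 'rV[R]_m.+1).
Hypothesis hu : unit_basis u.
Local Notation n := m.+1.
Local Notation U := (\matrix_i u i).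

Lemma mulmx_rows (c : 'rV[R]_n) : c *m U = \sum_i c ord0 i *: u i.
Proof.
rewrite mulmx_sum_row; apply: eq_bigr => i _; congr (_ *: _).
by apply/rowP => j; rewrite !mxE.
Qed.

Lemma basis_unitmx : U \in unitmx.
Proof.
case: hu => /andP[_ fu] _.
rewrite -row_free_unit; apply/inj_row_free => c; rewrite mulmx_rows => c0.
apply/rowP => i; rewrite mxE.
have /freeP/(_ (fun i => c ord0 i)) := fu; apply.
rewrite -[RHS]c0; apply: eq_bigr => j _; congr (_ *: _).
by rewrite nth_mktuple.
Qed.

(** The frame obtained from the basis by moving w into the place of u_i, which
    is put in front. *)
Definition frame i (w : 'rV[R]_n) : 'M[R]_n :=
  \matrix_(k, l) (if unlift ord0 k is Some j then u (lift i j) else w) ord0 l.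

(** Replacing one vector of a basis multiplies the determinant by the coordinate
    of the new vector along the old one: Laplace expansion along that row gives
    w times the adjugate of the basis. The sign of the permutation that brings
    the row to the front is why absolute values appear. *)
Lemma det_frame i w : `|\det (frame i w)| = `|(w *m invmx U) ord0 i| * `|\det U|.
Proof.
rewrite (expand_det_row _ ord0).
have -> : \sum_j frame i w ord0 j * cofactor (frame i w) ord0 j =
    (-1) ^+ i * \sum_j w ord0 j * cofactor U i j.
  rewrite mulr_sumr; apply: eq_bigr => j _.
  rewrite mxE unlift_none /cofactor.
  have -> : row' ord0 (col' j (frame i w)) = row' i (col' j U).
    by apply/matrixP => k l; rewrite !mxE liftK.
  rewrite [RHS]mulrCA; congr (_ * _); rewrite [RHS]mulrA -exprD addnA [in RHS]exprD.
  by rewrite addnn -mul2n exprM sqrrN !expr1n mul1r.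
rewrite normrM normrX normrN1 expr1n mul1r -normrM; congr `|_|.
have -> : \sum_j w ord0 j * cofactor U i j = (w *m \adj U) ord0 i.
  by rewrite [RHS]mxE; apply: eq_bigr => j _; rewrite mxE.
rewrite -[in LHS](mulmxKV basis_unitmx w) -(mulmxA _ U) mul_mx_adj.
by rewrite mul_mx_scalar mxE mulrC.
Qed.

(** As N is orthogonal to the face, the product of one frame by the transpose of
    the other is block triangular, with blocks <w, N> and the Gram matrix. *)
Lemma frame_gram i (w N : 'rV[R]_n) :
  (forall j, dotp (u (lift i j)) N = 0) ->
  \det (frame i w) * \det (frame i N) = dotp w N * \det (face_gram u i).
Proof.
move=> Nu; rewrite -(det_tr (frame i N)) -det_mulmx.
rewrite (expand_det_col _ ord0) big_ord_recl big1 ?addr0; last first.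
  move=> j _; have -> : (frame i w *m (frame i N)^T) (lift ord0 j) ord0 =
      dotp (u (lift i j)) N.
    by rewrite mxE; apply: eq_bigr => k _; rewrite !mxE liftK unlift_none.
  by rewrite Nu mul0r.
congr (_ * _).
  by rewrite mxE; apply: eq_bigr => k _; rewrite !mxE !unlift_none.
rewrite /cofactor addn0 expr0 mul1r; congr (\det _).
apply/matrixP => j k; rewrite !mxE; apply: eq_bigr => l _.
by rewrite !mxE !liftK.
Qed.

Lemma basis_independent i (N : 'rV[R]_n) :
  (forall j, dotp (u (lift i j)) N = 0) -> (N *m invmx U) ord0 i = 0 -> N = 0.
Proof.
move=> Nu Ni; apply: dotp_eq0.
rewrite {1}(_ : N = \sum_i (N *m invmx U) ord0 i *: u i); last first.
  by rewrite -mulmx_rows mulmxKV// basis_unitmx.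
rewrite dotpE mulmx_suml summxE big1// => k _.
rewrite -scalemxAl mxE -dotpE; case: (unliftP i k) => [j ->|->].
  by rewrite Nu mulr0.
by rewrite Ni mul0r.
Qed.

Lemma face_gram_gt0 i (N : 'rV[R]_n) :
  (forall j, dotp (u (lift i j)) N = 0) -> N != 0 -> 0 < \det (face_gram u i).
Proof.
move=> Nu N0.
have NN : 0 < dotp N N.
  by rewrite lt_neqAle dotp_ge0 andbT eq_sym; apply: contra N0 => /eqP/dotp_eq0 ->.
have dN : \det (frame i N) != 0.
  rewrite -normr_eq0 det_frame mulf_neq0 ?normr_eq0//.
    by apply: contra N0 => /eqP/(basis_independent Nu) ->.
  by rewrite -unitfE -unitmxE basis_unitmx.
rewrite -(pmulr_rgt0 _ NN) -(frame_gram _ Nu) -expr2.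
by rewrite lt_neqAle sqr_ge0 andbT eq_sym expf_neq0.
Qed.

End basis_matrix.

(** * The cone, its boundary and its axis *)

Section cone_geometry.
Context {R : realType} (m : nat) (u : 'I_m.+1 -> 'rV[R]_m.+1).
Hypothesis hu : unit_basis u.
Local Notation n := m.+1.
Local Notation U := (\matrix_i u i).
Local Notation coord y := ((y : 'rV[R]_n) *m invmx U).

Lemma coneE x : cone u x = [set y | forall i, 0 <= coord (y - x) ord0 i].
Proof.
apply/seteqP; split => y /=.
  move=> [c c0 ->] i; rewrite addrC addKr.
  rewrite (_ : \sum_i _ = (\row_i c i) *m U).
    by rewrite mulmxK ?basis_unitmx// mxE.
  by rewrite mulmx_rows; apply: eq_bigr => k _; rewrite mxE.
move=> yx; exists (fun i => coord (y - x) ord0 i) => //.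
by rewrite -mulmx_rows mulmxKV ?basis_unitmx// addrC subrK.
Qed.

Lemma coordB x y i : coord (x - y) ord0 i = coord x ord0 i - coord y ord0 i.
Proof. by rewrite mulmxBl [LHS]mxE [X in _ + X]mxE. Qed.

Lemma coordZ (a : R) x i : coord (a *: x) ord0 i = a * coord x ord0 i.
Proof. by rewrite -scalemxAl [LHS]mxE. Qed.

Lemma coord_edge i k : coord (u i) ord0 k = (k == i)%:R.
Proof.
have -> : u i = delta_mx ord0 i *m U.
  by rewrite -rowE; apply/rowP => j; rewrite !mxE.
by rewrite mulmxK ?basis_unitmx// mxE eqxx.
Qed.

Lemma mulmx_entry_continuous (A : 'M[R]_n) i :
  continuous (fun y : 'rV[R]_n => (y *m A) ord0 i).
Proof.
under eq_fun do rewrite mxE.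
apply: continuous_big => [|j _ y]; first exact: add_continuous.
apply: (@cvgM _ _ _ (nbhs_filter y)).
  exact: (@coord_continuous R 1 n ord0 j y).
exact: cvg_cst.
Qed.

Lemma coord_shift_continuous x i :
  continuous (fun y : 'rV[R]_n => coord (y - x) ord0 i).
Proof.
rewrite (_ : (fun y => _) = fun y : 'rV[R]_n =>
    coord y ord0 i - coord x ord0 i); last first.
  by apply/funext => y; rewrite coordB.
move=> y; apply: (@cvgB _ _ _ _ (nbhs_filter y)); last exact: cvg_cst.
exact: mulmx_entry_continuous.
Qed.

Lemma interior_coneE x :
  (cone u x)° = [set y | forall i, 0 < coord (y - x) ord0 i].
Proof.
rewrite coneE; apply/seteqP; split => y.
  rewrite /interior => /= yx i.
  have shift : (y - e *: u i) @[e --> (0 : R)] --> y.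
    rewrite -[X in _ --> X]subr0 -(scale0r (u i)).
    by apply: cvgB; [exact: cvg_cst|exact: cvgZr_tmp].
  have /nbhs_ballP[e /= e0 be] := shift _ yx.
  have := be (e / 2); rewrite /ball/= sub0r normrN gtr0_norm ?divr_gt0//.
  rewrite ltr_pdivrMr// ltr_pMr// ltr1n => /(_ isT i).
  rewrite addrAC coordB coordZ coord_edge eqxx mulr1.
  by rewrite subr_ge0; apply: lt_le_trans; rewrite divr_gt0.
move=> yx; rewrite /interior/=.
suff : \forall z \near y, forall i, 0 < coord (z - x) ord0 i.
  by apply: filterS => z zx i; exact/ltW/zx.
refine (@filter_forall _ _ (fun i (z :
  'rV[R]_n) => 0 < coord (z - x) ord0 i) (nbhs y) _ _) => i.
by have /cvgr_gt := @coord_shift_continuous x i y; apply; exact: yx.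
Qed.

(** In coordinates the cone is a closed orthant. *)
Lemma closed_cone x : closed (cone u x).
Proof.
rewrite coneE (_ : [set y | _] = \bigcap_(i in [set: 'I_n])
    ((fun y => coord (y - x) ord0 i) @^-1` [set r | 0 <= r])); last first.
  by apply/seteqP; split => y /= yx i; [move=> _|]; exact: yx.
apply: closed_bigI => i _; apply: closed_comp => [y _|].
  exact: coord_shift_continuous.
exact: closed_ge.
Qed.

Lemma frontier_coneE x : frontier (cone u x) =
  [set y | (forall i, 0 <= coord (y - x) ord0 i) /\
           exists i, coord (y - x) ord0 i = 0].
Proof.
rewrite /frontier -(closure_id _).1; last exact: closed_cone.
rewrite interior_coneE coneE; apply/seteqP; split => y /=.
  move=> [yx ny]; split => //; apply: contrapT => yN; apply: ny => i.
  rewrite lt_neqAle yx andbT eq_sym; apply/eqP => yi; apply: yN.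
  by exists i.
by move=> [yx [i yi]]; split => // /(_ i); rewrite yi ltxx.
Qed.

Section axis.
Variables (alpha : 'rV[R]_n) (beta : R).
Hypothesis halpha : cone_axis u alpha beta.

Lemma axis_coord_gt0 i : 0 < coord alpha ord0 i.
Proof.
case: halpha => _ + _; rewrite interior_coneE => /(_ i).
by rewrite subr0.
Qed.

(** Both sides are the volume of the parallelotope spanned by the axis and the
    edges of a face: height times area on the left, determinant on the right.
    This is where the common angle beta becomes the Jacobian factor of the
    parametrization of the cone by its axis and a face. *)
Lemma axis_face_volume i : sin beta * Num.sqrt (\det (face_gram u i)) =
  coord alpha ord0 i * `|\det U|.
Proof.
case: (halpha) => alpha1 _ /(_ i) [N [N0 oN ->]].
have Nu j : dotp (u (lift i j)) N = 0.
  apply: oN; apply: memv_span; apply/mapP; exists (lift i j) => //.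
  by rewrite mem_enum inE/= eq_sym neq_lift.
set g := \det (face_gram u i).
have g0 : 0 < g := face_gram_gt0 hu Nu N0.
have eN : 0 < enorm N.
  rewrite sqrtr_gt0 lt_neqAle dotp_ge0 andbT eq_sym.
  by apply: contra N0 => /eqP/dotp_eq0 ->.
have dN : `|\det (frame u i N)| = enorm N * Num.sqrt g.
  apply/eqP; rewrite -(eqrXn2 (n := 2)) ?mulr_ge0 ?sqrtr_ge0//.
  rewrite real_normK ?num_real// exprMn sqr_enorm sqr_sqrtr ?(ltW g0)//.
  by rewrite expr2 frame_gram.
have dA : `|\det (frame u i alpha)| * (enorm N * Num.sqrt g) = `|dotp alpha N| * g.
  by rewrite -dN -normrM frame_gram// normrM (gtr0_norm g0).
rewrite -(gtr0_norm (axis_coord_gt0 i)) -(det_frame hu) /angle alpha1 mul1r.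
rewrite sin_angle_complement; last first.
  rewrite normrM normfV (gtr0_norm eN) ler_pdivrMr// mul1r.
  by apply: le_trans (cauchy_schwarz _ _) _; rewrite alpha1 mul1r.
rewrite normrM normfV (gtr0_norm eN).
have sg : Num.sqrt g != 0 by rewrite sqrtr_eq0 -ltNge.
apply: (mulIf (mulf_neq0 (lt0r_neq0 eN) sg)); rewrite dA.
rewrite -[in RHS](sqr_sqrtr (ltW g0)) expr2.
by field; rewrite gt_eqF.
Qed.

End axis.

End cone_geometry.

(** * The sectors of an orthant *)

Section measurable_comparisons.
Context d (T : measurableType d) {R : realType}.
Variables f g : T -> measurableTypeR R.
Hypotheses (mf : measurable_fun setT f) (mg : measurable_fun setT g).

Lemma measurable_set_le : measurable [set x | f x <= g x].
Proof.
have := measurable_funB mg mf measurableT (measurable_itv `[0, +oo[).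
rewrite setTI; congr measurable; apply/seteqP; split => x /=.
  by rewrite in_itv/= andbT subr_ge0.
by rewrite in_itv/= andbT subr_ge0.
Qed.

Lemma measurable_set_eq : measurable [set x | f x = g x].
Proof.
have := measurable_funB mg mf measurableT (measurable_set1 0).
rewrite setTI; congr measurable; apply/seteqP; split => x /=.
  by move/eqP; rewrite subr_eq0 => /eqP.
by move=> ->; rewrite subrr.
Qed.

End measurable_comparisons.

Section orthant.
Context {R : realType} (n : nat).

Definition orthant : set 'rV[R]_n := [set c | forall i, 0 <= c ord0 i].

Lemma measurable_orthant : measurable orthant.
Proof.
rewrite (_ : orthant = [set c | forall i, `[0, +oo[%classic (c ord0 i :
  measurableTypeR R)]).
  by apply: (@measurable_box R n (fun=> `[0, +oo[%classic)) => i;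
    exact: measurable_itv.
by apply/seteqP; split => c cP i; have := cP i; rewrite /= in_itv/= andbT.
Qed.

End orthant.
Arguments orthant {R} n.

Section sectors.
Context {R : realType} (m : nat) (a : 'rV[R]_m.+1).
Local Notation n := m.+1.
Hypothesis a_gt0 : forall i, 0 < a ord0 i.
Notation leb1 := (@lebesgue_measure R).
Notation leb := (lebesgue_rV :
  forall n, {sigma_finite_measure set 'rV[R]_n -> \bar R}).

(** In the coordinates of the basis, with a the coordinates of the axis: the
    point reached by following the axis for a time p.1 and then moving inside
    the i-th face by p.2. *)
Definition sector_param (i : 'I_n) (p : measurableTypeR R * 'rV[R]_m) : 'rV[R]_n :=
  \row_k (p.1 * a ord0 k + if unlift i k is Some j then p.2 ord0 j else 0).

(** The part of the orthant where c_i / a_i is the least of the ratios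
    c_j / a_j, written without division: the i-th face swept along the axis. *)
Definition sector (i : 'I_n) : set 'rV[R]_n :=
  [set c | 0 <= c ord0 i /\ forall j, c ord0 i * a ord0 j <= c ord0 j * a ord0 i].

Lemma sector_param_eq i p : sector_param i p ord0 i = p.1 * a ord0 i.
Proof. by rewrite mxE unlift_none addr0. Qed.

Lemma sector_param_lift i p j :
  sector_param i p ord0 (lift i j) = p.1 * a ord0 (lift i j) + p.2 ord0 j.
Proof. by rewrite mxE liftK. Qed.

Lemma sector_paramP i p :
  sector i (sector_param i p) <-> 0 <= p.1 /\ orthant m p.2.
Proof.
have ai := a_gt0 i.
split=> [[]|[p0 c0]]; rewrite /sector/= sector_param_eq.
  rewrite pmulr_lge0// => p0 H; split => // j.
  have := H (lift i j); rewrite sector_param_lift.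
  by rewrite mulrAC mulrDl lerDl pmulr_lge0.
split=> [|k]; first by rewrite mulr_ge0// ltW.
case: (unliftP i k) => [j ->|->]; last by rewrite sector_param_eq.
by rewrite sector_param_lift mulrAC mulrDl lerDl pmulr_lge0.
Qed.

Lemma measurable_sector_param i : measurable_fun setT (sector_param i).
Proof.
apply: measurable_fun_rV => k; under eq_fun do rewrite mxE.
apply: measurable_funD.
  by apply: measurable_funM; [exact: measurable_fst|exact: measurable_cst].
case: (unlift i k) => [j|]; last exact: measurable_cst.
exact: (measurableT_comp (measurable_coor j) measurable_snd).
Qed.

(** At time t the section is a translate of the unit cube if t a_i lies in
    [0, 1], and is empty otherwise. *)
Let unit_cube_sector i :
  (leb1 \x leb m)%E (sector_param i @^-1` @unit_cube R n) = (a ord0 i)^-1%:E.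
Proof.
have ai := a_gt0 i.
rewrite /product_measure1 /=.
pose I : set (measurableTypeR R) := `[0, (a ord0 i)^-1]%classic.
transitivity (\int[leb1]_(t in I) (1%E : \bar R))%E; last first.
  rewrite integral_cst ?mul1e//; last exact: measurable_itv.
  by rewrite [LHS](lebesgue_measure_itv `[0,
    (a ord0 i)^-1])/= lte_fin invr_gt0 ai sube0.
rewrite [RHS]integral_mkcond; apply: eq_integral => t _; rewrite patchE.
have It : (t \in I) = (0 <= t * a ord0 i <= 1).
  by rewrite /I mem_setE in_itv/= -[(a ord0 i)^-1]div1r ler_pdivlMr// pmulr_lge0.
case: ifPn; rewrite It => ti; last first.
  rewrite (_ : xsection _ _ = set0) ?measure0//.
  apply/seteqP; split => c //; rewrite /xsection/= => /set_mem/(_ i).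
  by rewrite sector_param_eq/= in_itv/= (negbTE ti).
pose w : 'rV[R]_m := \row_j (t * a ord0 (lift i j)).
rewrite -(lebesgue_rV_unit_cube m).
rewrite -[RHS](lebesgue_rV_shift w); last exact: measurable_unit_cube.
congr (leb m _); apply/seteqP; split => c; rewrite /xsection/= => ct.
  move=> j; have := set_mem ct (lift i j).
  by rewrite /= sector_param_lift/= !mxE addrC.
apply/mem_set; move=> k; case: (unliftP i k) => [j ->|->].
  by rewrite /= sector_param_lift/= addrC; have := ct j; rewrite !mxE.
by rewrite sector_param_eq/= in_itv.
Qed.

(** The parametrization is a linear bijection, so it scales the measure by a
    constant, which is found on the unit cube. *)
Lemma lebesgue_sector_param i E : measurable E ->
  (leb1 \x leb m)%E (sector_param i @^-1` E) = ((a ord0 i)^-1%:E * leb n E)%E.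
Proof.
move=> mE; have ai := a_gt0 i.
pose phi c := sector_param i (@uncons_rV R m c).
have phiE D : leb n (phi @^-1` D) = (leb1 \x leb m)%E (sector_param i @^-1` D).
  rewrite [LHS]lebesgue_rVS; congr (product_measure1 _ _ _).
  by apply/funext => p; rewrite /phi/= cons_rVK.
have mphi : measurable_fun setT phi.
  exact: measurableT_comp (measurable_sector_param i) (@measurable_uncons_rV R m).
have := @lebesgue_rV_additive R n phi mphi _ _ E (@unit_cube R n) mE
  (@measurable_unit_cube R n).
rewrite lebesgue_rV_unit_cube mule1 !phiE unit_cube_sector => <- //.
- move=> x y; apply/rowP => k; rewrite !mxE.
  case: (unliftP i k) => [j ->|->]; rewrite ?liftK ?unlift_none /= !mxE; ring.
- move=> y.
  exists (cons_rV (y ord0 i / a ord0 i,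
     \row_j (y ord0 (lift i j) - y ord0 i / a ord0 i * a ord0 (lift i j)))).
  rewrite /phi cons_rVK; apply/rowP => k; case: (unliftP i k) => [j ->|->].
    by rewrite sector_param_lift/= mxE addrC subrK.
  by rewrite sector_param_eq/= mulfVK// gt_eqF.
Qed.

Lemma measurable_sector i : measurable (sector i).
Proof.
have mc (j : 'I_n) (b : R) : measurable_fun setT (fun c :
  'rV[R]_n => c ord0 j * b : measurableTypeR R).
  by apply: measurable_funM; [exact: measurable_coor|exact: measurable_cst].
rewrite (_ : sector i = [set c | 0 <= c ord0 i] `&`
    \bigcap_(j in [set: 'I_n]) [set c | c ord0 i * a ord0 j <= c ord0 j * a ord0
      i]); last first.
  apply/seteqP; split => c /=; first by move=> [c0 cj]; split => // j _; exact: cj.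
  by move=> [c0 cj]; split => // j; exact: cj.
apply: measurableI.
  exact: (measurable_set_le (measurable_cst (0 :
    measurableTypeR R)) (measurable_coor i)).
by apply: fin_bigcap_measurable => // j _; exact: measurable_set_le.
Qed.

Definition sector_overlap (i j : 'I_n) : set 'rV[R]_n :=
  [set c | c ord0 i * a ord0 j = c ord0 j * a ord0 i].

Lemma measurable_sector_overlap i j : measurable (sector_overlap i j).
Proof.
by apply: measurable_set_eq; (apply: measurable_funM;
  [exact: measurable_coor|exact: measurable_cst]).
Qed.

(** Seen through the parametrization of the i-th sector, the overlap with the
    j-th one is a coordinate hyperplane. *)
Lemma sector_overlap_null i j : i != j -> leb n (sector_overlap i j) = 0%E.
Proof.
move=> ij; have ai := a_gt0 i.
have : ((a ord0 i)^-1%:E * leb n (sector_overlap i j) = 0)%E.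
  rewrite -lebesgue_sector_param; last exact: measurable_sector_overlap.
  move: ij; case: (unliftP i j) => [k ->|->]; last by rewrite eqxx.
  move=> _; rewrite (_ : _ @^-1` _ = setT `*` [set c : 'rV[R]_m | c ord0 k = 0]).
    rewrite product_measure1E//; last exact: measurable_hyperplane.
    by rewrite [X in (_ * X)%E](lebesgue_rV_hyperplane k 0) mule0.
  apply/seteqP; split => -[t c] /=;
      rewrite /sector_overlap/= sector_param_eq sector_param_lift/=.
    move=> tc; split => //.
    by apply: (mulIf (lt0r_neq0 ai)); move: tc; nra.
  by move=> [_ ->]; rewrite addr0 mulrAC.
by move=> /eqP; rewrite mule_eq0 eqe invr_eq0 gt_eqF//= => /eqP.
Qed.

(** Outside the null overlaps a point of the orthant lies in the only sector
    whose index minimizes c_i / a_i. *)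
Lemma sum_indic_sectors :
  {ae leb n, forall c, \sum_i \1_(sector i) c = \1_(orthant n) c :> R}.
Proof.
have : {ae leb n, forall c : 'rV[R]_n, forall p : 'I_n * 'I_n, p.1 != p.2 ->
    c ord0 p.1 * a ord0 p.2 != c ord0 p.2 * a ord0 p.1}.
  apply: filter_forall => -[i j] /=; have [->|ij] := eqVneq i j.
    by apply: aeW => c.
  exists (sector_overlap i j); split.
  - exact: measurable_sector_overlap.
  - exact: sector_overlap_null.
  - by move=> c /= cN; apply: contrapT => /eqP cij; apply: cN.
apply: filterS => c cP.
have [c0|nc0] := boolP (c \in orthant n); last first.
  rewrite [RHS]indicE (negbTE nc0) big1// => i _; rewrite indicE memNset//.
  move=> [ci cs]; move/negP: nc0; apply; apply/mem_set => j.
  rewrite -(pmulr_lge0 _ (a_gt0 i)); apply: le_trans (cs j).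
  by rewrite mulr_ge0// ltW.
rewrite [RHS]indicE c0; have {}c0 := set_mem c0.
pose i := [arg min_(i < ord0) (c ord0 i / a ord0 i)]%O.
have iP j : c ord0 i * a ord0 j <= c ord0 j * a ord0 i.
  rewrite /i; case: arg_minP => // k _ /(_ j isT).
  by rewrite ler_pdivrMr// mulrAC ler_pdivlMr.
rewrite (bigD1 i)//= indicE mem_set; last by split.
rewrite big1 ?addr0// => j ji; rewrite indicE memNset// => -[_ /(_ i) ij].
have := cP (i, j); rewrite /= eq_sym => /(_ ji)/eqP; apply.
by apply/le_anti; rewrite iP ij.
Qed.

End sectors.

(** * Real-valued integrals and iterated integration *)

Section real_integrals.
Context d (T : measurableType d) {R : realType}.
Variable mu : {measure set T -> \bar R}.

Lemma Rintegral_sum (I : Type) (s : seq I) (F : I -> T -> R) :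
  (forall i, mu.-integrable setT (EFin \o F i)) ->
  \int[mu]_x (\sum_(i <- s) F i x) = \sum_(i <- s) \int[mu]_x F i x.
Proof.
move=> iF; elim: s => [|i s ih].
  by under eq_Rintegral do rewrite big_nil; rewrite /Rintegral integral0 big_nil.
under eq_Rintegral do rewrite big_cons.
rewrite big_cons -ih RintegralD//.
have := integrable_sum measurableT s (P := xpredT) (fun i _ => iF i).
by apply: eq_integrable => // x _; rewrite /= sumEFin.
Qed.

Lemma integrable_fine (F : T -> \bar R) : mu.-integrable setT F ->
  mu.-integrable setT (EFin \o (fine \o F)).
Proof.
move=> iF; have mF := measurable_int _ iF.
apply: le_integrable iF => //.
  by apply/measurable_EFinP; exact: measurableT_comp.
by move=> x _ /=; case: (F x) => //= *; rewrite ?normr0 ?leey.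
Qed.

(** The inner integrals of an integrable function may be infinite on a null set,
    where fine replaces them by 0; this does not affect the outer integral. *)
Lemma Rintegral_fine (F : T -> \bar R) : mu.-integrable setT F ->
  \int[mu]_x fine (F x) = fine (\int[mu]_x F x)%E.
Proof.
move=> iF; have mF := measurable_int _ iF.
congr fine; apply: ae_eq_integral => //.
  by apply: measurable_int (integrable_fine iF).
have := integrable_ae measurableT iF; apply: filterS => x xF _ /=.
by rewrite fineK// xF.
Qed.

Lemma ae_eq_Rintegral (f g : T -> R) :
  measurable_fun setT f -> measurable_fun setT g ->
  {ae mu, forall x, f x = g x} -> \int[mu]_x f x = \int[mu]_x g x.
Proof.
move=> mf mg fg; congr fine; apply: ae_eq_integral => //.
- exact/measurable_EFinP.
- exact/measurable_EFinP.
- by apply: filterS fg => x -> .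
Qed.

End real_integrals.

Section product_swap.
Context d1 d2 (T1 : measurableType d1) (T2 : measurableType d2) {R : realType}.
Variables (m1 : {sigma_finite_measure set T1 -> \bar R}).
Variables (m2 : {sigma_finite_measure set T2 -> \bar R}).

Lemma measurable_pair_swap : measurable_fun setT (fun p : T2 * T1 => (p.2, p.1)).
Proof. by apply/measurable_fun_pair;
  [exact: measurable_snd|exact: measurable_fst]. Qed.

Lemma product_measure_swap E : measurable E ->
  (m2 \x m1)%E ((fun p => (p.2, p.1)) @^-1` E) = (m1 \x m2)%E E.
Proof.
move=> mE; have ms := measurable_pair_swap.
rewrite -[LHS]/(pushforward (m2 \x m1)%E (fun p => (p.2, p.1)) E).
apply/esym; apply: product_measure_unique => // A B mA mB.
rewrite /= /pushforward (_ : _ @^-1` _ = B `*` A); last first.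
  by apply/seteqP; split => -[x y] [].
by rewrite product_measure1E// muleC.
Qed.

End product_swap.

Section real_fubini.
Context d1 d2 (T1 : measurableType d1) (T2 : measurableType d2) {R : realType}.
Variables (m1 : {sigma_finite_measure set T1 -> \bar R}).
Variables (m2 : {sigma_finite_measure set T2 -> \bar R}).
Variable f : T1 * T2 -> R.
Hypothesis intf : (m1 \x m2)%E.-integrable setT (EFin \o f).

Lemma integrable_inner_Rintegral :
  m1.-integrable setT (EFin \o (fun x => \int[m2]_y f (x, y))).
Proof. exact: (integrable_fine (integrable_fubini_F intf)). Qed.

Lemma Rintegral12 :
  \int[m1]_x (\int[m2]_y f (x, y)) = \int[(m1 \x m2)%E]_z f z.
Proof.
rewrite [LHS](Rintegral_fine (integrable_fubini_F intf)).
by congr fine; exact: integral12_prod_meas1.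
Qed.

End real_fubini.

Section affine_maps.
Context {R : realType} (n : nat).

Lemma L1_affine (f : 'rV[R]_n -> R) x (A : 'M[R]_n) : A \in unitmx ->
  L1 f -> L1 (fun c => f (x + c *m A)).
Proof.
move=> uA; have [k kE] := lebesgue_rV_unitmx uA.
apply: (@integrable_comp _ _ _ _ _ (lebesgue_rV n) (lebesgue_rV n)
  (fun c => x + c *m A) k) => [|E mE].
  rewrite (_ : (fun c => _) = (fun y => y + x) \o (fun c => c *m A)).
    by apply: measurableT_comp;
      [exact: measurable_shift_rV|exact: measurable_linear].
  by apply/funext => c /=; rewrite addrC.
have mE' : measurable ((fun y => y + x) @^-1` E).
  by rewrite -[X in measurable X]setTI; exact: measurable_shift_rV.
apply: etrans (etrans (kE _ mE') _).
  by congr (lebesgue_rV n _); apply/funext => c /=; rewrite addrC.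
by congr (_ * _)%E; exact: lebesgue_rV_shift.
Qed.

Lemma L1_measurable (f : 'rV[R]_n -> R) : L1 f -> measurable_fun setT f.
Proof. by move=> /measurable_int /measurable_EFinP. Qed.

End affine_maps.

(** * From the boundary of the cone to the whole cone *)

Lemma fineZ {R : realFieldType} (k : R) (x : \bar R) :
  0 < k -> fine (k%:E * x)%E = k * fine x.
Proof.
move=> k0; case: x => [r//| |] /=.
  by rewrite gt0_muley ?lte_fin//= mulr0.
by rewrite gt0_muleNy ?lte_fin//= mulr0.
Qed.

Section cone_integral.
Context {R : realType} (m : nat) (u : 'I_m.+1 -> 'rV[R]_m.+1).
Context (alpha y1 : 'rV[R]_m.+1) (beta : R).
Hypothesis hu : unit_basis u.
Hypothesis halpha : cone_axis u alpha beta.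
Hypothesis hy1 : face_normal u alpha beta ord0 y1.
Local Notation n := m.+1.
Local Notation U := (\matrix_i u i).
Notation leb1 := (@lebesgue_measure R).
Notation leb := (lebesgue_rV :
  forall n, {sigma_finite_measure set 'rV[R]_n -> \bar R}).

Let a := alpha *m invmx U.
Let a_gt0 i : 0 < a ord0 i. Proof. exact: axis_coord_gt0 halpha i. Qed.

Lemma measurable_frontier_cone x : measurable (frontier (cone u x)).
Proof.
rewrite frontier_coneE//.
pose co (y : 'rV[R]_n) := (y - x) *m invmx U.
have mco : measurable_fun setT co.
  rewrite (_ : co = (fun y => y *m invmx U) \o (fun y => y + - x))//.
  by apply: measurableT_comp; [exact: measurable_linear|exact: measurable_shift_rV].
rewrite (_ : [set y | _] = co @^-1` (orthant n `&`
    \bigcup_(i in [set: 'I_n]) [set c | c ord0 i = 0])); last first.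
  apply/seteqP; split => y /= [y0 [i]]; first by move=> yi; split => //; exists i.
  by move=> _ yi; split => //; exists i.
rewrite -[X in measurable X]setTI; apply: mco => //; apply: measurableI.
  exact: measurable_orthant.
by apply: fin_bigcup_measurable => // i _; exact: measurable_hyperplane.
Qed.

Lemma face_param_sector i x t (c : 'rV[R]_m) :
  face_param u i (x + t *: alpha) c = x + sector_param a i (t, c) *m U.
Proof.
rewrite /face_param -addrA; congr (_ + _).
have -> : sector_param a i (t, c) = t *: a +
    \row_k (if unlift i k is Some j then c ord0 j else 0).
  by apply/rowP => k; rewrite !mxE.
rewrite mulmxDl -scalemxAl mulmxKV ?basis_unitmx//; congr (_ + _).
rewrite mulmx_rows (bigD1_ord i)//= mxE unlift_none scale0r add0r.
by apply: eq_bigr => j _; rewrite mxE liftK.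
Qed.

Lemma frontier_face i x (c : 'rV[R]_m) :
  frontier (cone u x) (face_param u i x c) <-> orthant m c.
Proof.
rewrite frontier_coneE//=.
have E k : ((face_param u i x c - x) *m invmx U) ord0 k =
    if unlift i k is Some j then c ord0 j else 0.
  have := face_param_sector i x 0 c; rewrite scale0r addr0 => ->.
  by rewrite addrC addKr mulmxK ?basis_unitmx// mxE mul0r add0r.
split => [[c0 _] j|c0]; first by have := c0 (lift i j); rewrite E liftK.
split => [k|]; last by exists i; rewrite E unlift_none.
by rewrite E; case: unlift => // j; exact: c0.
Qed.

(** The face measure is an image measure on the hyperplane that carries the
    face; restricting to the boundary of the cone selects the nonnegative
    parameters. Where f is not integrable on the face, both sides are the same
    default value. *)
Lemma face_integral (f : 'rV[R]_n -> R) i x : measurable_fun setT f ->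
  \int[face_measure u i x]_(y in frontier (cone u x)) f y =
  Num.sqrt (\det (face_gram u i)) *
    \int[leb m]_(c in orthant m) f (face_param u i x c).
Proof.
move=> mf; set s := Num.sqrt _.
have s0 : 0 < s.
  have := mulr_gt0 (a_gt0 i) (_ : 0 < `|\det U|).
  rewrite -(axis_face_volume hu halpha) normr_gt0 -unitfE -unitmxE.
  move=> /(_ (basis_unitmx hu)) H.
  by rewrite /s lt_neqAle sqrtr_ge0 andbT eq_sym; apply: contraTneq H => ->;
    rewrite mulr0 ltxx.
have sV0 : 0 <= s^-1 by rewrite invr_ge0 ltW.
have mF := measurable_frontier_cone x.
have push E : measurable E -> leb m (face_param u i x @^-1` E) =
    ((NngNum sV0)%:num%:E * face_measure u i x E)%E.
  move=> mE /=; rewrite /face_measure /mscale/= muleA -EFinM mulVf ?gt_eqF//.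
  by rewrite mul1e.
rewrite Rintegral_mkcond [in RHS]Rintegral_mkcond.
have mg : measurable_fun setT (EFin \o (f \_ (frontier (cone u x)))).
  by apply/measurable_EFinP; apply/(measurable_restrictT _ mF);
    exact: measurable_funTS.
have := congr1 fine (integral_comp (@measurable_face_param R m u i x) push mg).
rewrite fineZ ?invr_gt0//= => /(congr1 ( *%R s)).
rewrite mulrA mulfV ?gt_eqF// mul1r => H; apply: etrans (esym H) _.
congr (_ * _); congr fine.
apply: eq_integral => c _ /=; rewrite !patchE; congr EFin.
have := frontier_face i x c.
case: ifPn => [/set_mem xF|xF] FO; case: ifPn => [/set_mem cO|cO] //.
  by case/negP: cO; apply/mem_set/FO.
by case/negP: xF; apply/mem_set/FO.
Qed.

(** f near the cone with vertex x, read in coordinates and cut to a sector. *)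
Definition sector_integrand (f : 'rV[R]_n -> R) x i : 'rV[R]_n -> R :=
  (fun c => f (x + c *m U)) \_ (sector a i).

Lemma integrable_sector f x i : L1 f -> L1 (sector_integrand f x i).
Proof.
move=> /(L1_affine x (basis_unitmx hu)) ig.
have mS := measurable_sector a i.
have := (integrable_mkcond _ mS).1 (integrableS measurableT mS (@subsetT _ _) ig).
by rewrite /L1 /sector_integrand restrict_EFin.
Qed.

Let iaV0 i : 0 <= (a ord0 i)^-1. Proof. by rewrite invr_ge0 ltW. Qed.

Let lebesgue_sector i E : measurable E ->
  ((leb1 \x leb m) (sector_param a i @^-1` E) = (NngNum
    (iaV0 i))%:num%:E * leb n E)%E.
Proof. exact: lebesgue_sector_param. Qed.

Lemma integrable_sector_param f x i : L1 f ->
  (leb1 \x leb m)%E.-integrable setT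
    (EFin \o (sector_integrand f x i \o sector_param a i)).
Proof.
move=> /(integrable_sector x i).
exact: (integrable_comp (measurable_sector_param a i) (@lebesgue_sector i)).
Qed.

Lemma Rintegral_sector_param f x i : L1 f ->
  \int[leb1]_t (\int[leb m]_c sector_integrand f x i (sector_param a i (t, c))) =
  (a ord0 i)^-1 * \int[leb n]_c sector_integrand f x i c.
Proof.
move=> if_; rewrite (Rintegral12 (integrable_sector_param x i if_)).
rewrite -fineZ ?invr_gt0//; congr fine.
have := integral_comp (measurable_sector_param a i) (@lebesgue_sector i).
by apply; apply: measurable_int (integrable_sector x i if_).
Qed.

(** The boundary of the cone moved along the axis to time t is made of the
    sections at time t of the sectors. *)
Lemma face_integral_sector f x t i : measurable_fun setT f ->
  (if 0 <= t then
     let x' := x + t *: alpha in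
     \int[face_measure u i x']_(y in frontier (cone u x')) f y
   else 0) =
  Num.sqrt (\det (face_gram u i)) *
    \int[leb m]_c sector_integrand f x i (sector_param a i (t, c)).
Proof.
move=> mf; case: ifPn => t0 /=.
  rewrite face_integral// Rintegral_mkcond; congr (_ * _);
    apply: eq_Rintegral => c _.
  rewrite /sector_integrand !patchE face_param_sector.
  have := sector_paramP a_gt0 i (t, c).
  case: ifPn => [/set_mem xF|xF] FO; case: ifPn => [/set_mem cO|cO] //.
    by case/negP: cO; apply/mem_set/FO.
  by case/negP: xF; apply/mem_set; exact: (FO.1 cO).2.
rewrite [X in _ * X](_ : _ = 0) ?mulr0//.
rewrite (_ : (fun c => _) = fun=> 0) /Rintegral ?integral0//.
apply/funext => c; rewrite /sector_integrand patchE; case: ifPn => // /set_mem.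
by move/(sector_paramP a_gt0) => -[]; rewrite (negbTE t0).
Qed.

(** The key identity: the faces moved along the axis sweep the cone once, so
    integrating over them and then along the axis gives the integral over the
    cone. By Fubini it holds at every vertex x, not only almost everywhere. *)
Theorem axis_transform_cone f x : L1 f ->
  axis_transform u alpha y1 f x =
  `|\det U| * \int[leb n]_(c in orthant n) f (x + c *m U).
Proof.
move=> if_; have mf := L1_measurable if_.
have [_ _ dy] := hy1.
rewrite /axis_transform dy.
pose h i t := \int[leb m]_c sector_integrand f x i (sector_param a i (t, c)).
have ih i : leb1.-integrable setT (EFin \o h i).
  exact: (integrable_inner_Rintegral (integrable_sector_param x i if_)).
rewrite Rintegral_mkcond.
rewrite (_ : (fun t => _) = fun t =>
  \sum_(i < n) Num.sqrt (\det (face_gram u i)) * h i t); last first.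
  apply/funext => t; rewrite patchE mem_setE in_itv/= andbT.
  under [RHS]eq_bigr do rewrite -face_integral_sector//.
  by case: ifPn => t0; [|rewrite big1].
rewrite Rintegral_sum => [|i]; last first.
  have := integrableZl measurableT (Num.sqrt (\det (face_gram u i))) (ih i).
  exact: eq_integrable.
under eq_bigr => i _.
  rewrite RintegralZl// Rintegral_sector_param//.
  over.
rewrite mulr_sumr.
(* The factor 1 / a_i of the parametrization cancels against the volume. *)
under eq_bigr => i _.
  rewrite mulrA mulrA (axis_face_volume hu halpha) (mulrC
    (_ ord0 i)) mulfK ?gt_eqF//.
  over.
rewrite /= -mulr_sumr; congr (_ * _).
rewrite -Rintegral_sum; last by move=> i; exact: integrable_sector.
rewrite [RHS]Rintegral_mkcond.
have mg := L1_measurable (L1_affine x (basis_unitmx hu) if_).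
apply: ae_eq_Rintegral.
- by apply: measurable_sum => i; exact: L1_measurable (integrable_sector x i if_).
- apply/(measurable_restrictT _ (@measurable_orthant R n)); exact: measurable_funTS.
apply: filterS (sum_indic_sectors a_gt0) => c cS.
have pE (D : set 'rV[R]_n) (g : 'rV[R]_n -> R) : (g \_ D) c = \1_D c * g c.
  by rewrite patchE indicE; case: ifP; rewrite ?mul1r ?mul0r.
rewrite pE -cS mulr_suml; apply: eq_bigr => i _.
exact: pE.
Qed.

End cone_integral.

(** * Corner differences and inversion almost everywhere *)

Section corner_differences.
Context {R : realType} (n : nat).
Implicit Types (y z : 'rV[R]_n) (t : R).

Lemma prod_natr_bool (P : 'I_n -> bool) :
  \prod_i (P i)%:R = [forall i, P i]%:R :> R.
Proof.
have [/forallP PT|/forallPn[i nPi]] := boolP [forall i, P i].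
  by rewrite big1// => i _; rewrite PT.
by rewrite (bigD1 i)//= (negbTE nPi) mul0r.
Qed.

(** In dimension one the difference of the half-lines starting at the two ends
    of an interval is the interval, with a sign if the ends are in the wrong
    order, that is if t is negative. *)
Let corner_difference1 (c t : R) : t != 0 ->
  \sum_(b : bool) Num.sg (half_sign b : R) * (0 <= c + half_sign b * t)%R%:R =
  Num.sg t * (- (`|t| / 2) <= c < `|t| / 2)%R%:R.
Proof.
move=> t0; rewrite big_bool /half_sign expr0 expr1 div1r mulN1r.
rewrite sgrN gtr0_sg ?invr_gt0// mulN1r mul1r.
have [tp|tn|t00] := ltgtP t 0; last by rewrite t00 eqxx in t0.
  rewrite ltr0_sg// ltr0_norm//.
  by case: (leP 0 (c + _ * t)) => ?; case: (leP 0 (c + _ * t)) => ?;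
    case: (leP _ c) => ?; case: (ltP c _) => ? /=; lra.
rewrite gtr0_sg// gtr0_norm//.
by case: (leP 0 (c + _ * t)) => ?; case: (leP 0 (c + _ * t)) => ?;
  case: (leP _ c) => ?; case: (ltP c _) => ? /=; lra.
Qed.

(** Inclusion-exclusion over the corners of a cube: expand the product over the
    coordinates of the one-dimensional differences. *)
Lemma sum_corner_orthants y z t : t != 0 ->
  \sum_(s : {ffun 'I_n -> bool})
     Num.sg (\prod_i (half_sign (s i) : R)) *
     \1_(orthant n) (y - (z - \row_i (half_sign (s i) * t))) =
  Num.sg t ^+ n * \1_(half_open_cube z `|t|) y.
Proof.
move=> t0.
transitivity (\prod_(i < n) \sum_(b : bool) Num.sg (half_sign b : R) *
    (0 <= (y ord0 i - z ord0 i) + half_sign b * t)%R%:R).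
  rewrite bigA_distr_bigA/=; apply: eq_bigr => s _.
  rewrite [RHS]big_split/= (big_morph Num.sg (@sgrM R) (sgr1 R)); congr (_ * _).
  rewrite prod_natr_bool indicE; congr (_%:R : R); congr nat_of_bool.
  apply/idP/forallP => [/set_mem yO i|yO].
    by have := yO i; rewrite !mxE opprB addrA addrAC.
  apply/mem_set => i; have := yO i.
  by rewrite !mxE opprB addrA addrAC.
under eq_bigr do rewrite corner_difference1//.
rewrite big_split/= prodr_const card_ord; congr (_ * _).
rewrite prod_natr_bool indicE; congr (_%:R : R); congr nat_of_bool.
by apply/forallP/idP => [yQ|/set_mem yQ]; first by apply/mem_set.
Qed.

End corner_differences.

Section inversion_ae.
Context {R : realType} (m : nat) (u v : 'I_m.+1 -> 'rV[R]_m.+1).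
Context (alpha y1 : 'rV[R]_m.+1) (beta : R).
Hypothesis hu : unit_basis u.
Hypothesis halpha : cone_axis u alpha beta.
Hypothesis hy1 : face_normal u alpha beta ord0 y1.
Hypothesis hv : forall i, v i = - u i.
Local Notation n := m.+1.
Local Notation U := (\matrix_i u i).
Notation leb := (lebesgue_rV :
  forall n, {sigma_finite_measure set 'rV[R]_n -> \bar R}).

Lemma norm_det_opp : `|\det (\matrix_i v i)| = `|\det U|.
Proof.
rewrite (_ : \matrix_i v i = - U); last by apply/matrixP => i j;
  rewrite !mxE hv mxE.
by rewrite -scaleN1r detZ normrM normrX normrN1 expr1n mul1r.
Qed.

Lemma axis_transform_coord f w : L1 f -> axis_transform u alpha y1 f (w *m U) =
  `|\det U| * \int[leb n]_y (\1_(orthant n) (y - w) * f (y *m U)).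
Proof.
move=> if_; rewrite (axis_transform_cone hu halpha hy1)//; congr (_ * _).
have mO := @measurable_orthant R n.
have mh := L1_measurable (L1_affine 0 (basis_unitmx hu) if_).
rewrite Rintegral_mkcond; congr fine.
pose k y := (\1_(orthant n) (y - w) * f (y *m U))%:E.
rewrite [RHS](_ : _ = \int[leb n]_y k y)%E//.
rewrite -[RHS](@integral_comp1 _ _ _ _ _ (leb n) (leb n) (fun c => c + w)) //.
- apply: eq_integral => c _; rewrite /k /= addrK patchE indicE mulmxDl addrC.
  by case: ifP; rewrite ?mul1r ?mul0r// addrC.
- exact: measurable_shift_rV.
- by move=> E mE; exact: lebesgue_rV_shift.
- apply/measurable_EFinP; apply: measurable_funM.
    apply: (@measurableT_comp _ _ _ _ _ _ (\1_(orthant n) : 'rV[R]_n -> R)).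
      exact: measurable_indic.
    exact: measurable_shift_rV.
  by move: mh; under eq_fun do rewrite add0r.
Qed.

(** The quotient of the inversion formula is exactly an average over a cube, in
    the coordinates of the basis; the sign of t^n for negative t is the sign
    produced by the corners. *)
Lemma corner_sum f x t : L1 f -> t != 0 ->
  (t ^+ n * `|\det (\matrix_i v i)|)^-1 *
    (\sum_(s : {ffun 'I_n -> bool})
       Num.sg (\prod_i (half_sign (s i) : R)) *
       axis_transform u alpha y1 f (x + \sum_i (half_sign (s i) * t) *: v i)) =
  cube_average (fun y => f (y *m U)) t (x *m invmx U).
Proof.
move=> if_ t0; set z := x *m invmx U; set D := \det U.
have uU := basis_unitmx hu.
have D0 : `|D| != 0 by rewrite normr_eq0 -unitfE -unitmxE.
have ih := L1_affine 0 uU if_.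
have {}ih : L1 (fun y => f (y *m U)) by move: ih; under eq_fun do rewrite add0r.
have mO := @measurable_orthant R n.
pose k (s : {ffun 'I_n -> bool}) y := \1_(orthant n) (y - (z - \row_i
  (half_sign (s i) * t))) *
  f (y *m U).
have ik s : (leb n).-integrable setT (EFin \o k s).
  apply: le_integrable (ih) => //.
    apply/measurable_EFinP; apply: measurable_funM; last exact: (L1_measurable ih).
    apply: (@measurableT_comp _ _ _ _ _ _ (\1_(orthant n) : 'rV[R]_n -> R)).
      exact: measurable_indic.
    exact: measurable_shift_rV.
  move=> y _ /=; rewrite lee_fin /k indicE normrM.
  by case: (_ \in _); rewrite ?normr1 ?mul1r// normr0 mul0r.
under eq_bigr => s _.
  rewrite (_ : x + _ = (z - \row_i (half_sign (s i) * t)) *m U); last first.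
    rewrite mulmxBl mulmxKV// mulmx_rows -sumrN; congr (_ + _).
    by apply: eq_bigr => i _; rewrite hv mxE scalerN.
  rewrite axis_transform_coord// -/D mulrCA.
  over.
rewrite -mulr_sumr.
transitivity ((t ^+ n * `|\det (\matrix_i v i)|)^-1 * (`|D| *
    \int[leb n]_y (Num.sg t ^+ n * (\1_(half_open_cube z `|t|) y * f (y *m U))))).
  congr (_ * (_ * _)).
  under eq_bigr => s _ do rewrite -(RintegralZl _ measurableT (ik s)).
  rewrite -Rintegral_sum; last first.
    move=> s; have := integrableZl measurableT (Num.sg (\prod_i half_sign
      (s i))) (ik s).
    exact: eq_integrable.
  apply: eq_Rintegral => y _; rewrite mulrA -sum_corner_orthants// mulr_suml.
  by apply: eq_bigr => s _; rewrite mulrA.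
rewrite norm_det_opp -/D /cube_average.
have mQ := measurable_half_open_cube z `|t|.
rewrite (_ : (fun y => _) = fun y => Num.sg t ^+ n *
    (((fun y => f (y *m U)) \_ (half_open_cube z `|t|)) y)); last first.
  apply/funext => y; rewrite patchE indicE.
  by case: ifP; rewrite ?mul1r ?mul0r.
rewrite RintegralZl//; last first.
  have := (integrable_mkcond _ mQ).1 (integrableS measurableT mQ (@subsetT _ _) ih).
  by rewrite restrict_EFin.
rewrite -Rintegral_mkcond.
set J := Rintegral _ _ _.
rewrite [X in X ^+ n * `|D|](numEsg t) exprMn.
have s0 : Num.sg t ^+ n != 0 by rewrite expf_neq0// sgr_eq0.
have p0 : `|t| ^+ n != 0 by rewrite expf_neq0// normr_eq0.
by field; rewrite s0 p0 D0.
Qed.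

(** Lebesgue differentiation holds at almost every coordinate vector, and
    linear bijections preserve null sets. *)
Theorem corner_sum_ae f : L1 f ->
  {ae leb n, forall x,
    (t ^+ n * `|\det (\matrix_i v i)|)^-1 *
    (\sum_(s : {ffun 'I_n -> bool})
       Num.sg (\prod_i (half_sign (s i) : R)) *
       axis_transform u alpha y1 f (x + \sum_i (half_sign (s i) * t) *: v i))
    @[t --> 0^'] --> f x}.
Proof.
move=> if_; have uU := basis_unitmx hu.
have ih := L1_affine 0 uU if_.
have {}ih : L1 (fun y => f (y *m U)) by move: ih; under eq_fun do rewrite add0r.
have [N [mN N0 hN]] := lebesgue_differentiation_cubes ih.
have uV : invmx U \in unitmx by rewrite unitmx_inv.
have [k kE] := lebesgue_rV_unitmx uV.
exists ((fun x => x *m invmx U) @^-1` N); split.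
- by rewrite -[X in measurable X]setTI; exact: measurable_linear.
- by apply: etrans (kE _ mN) _; rewrite [X in (_ * X)%E]N0 mule0.
move=> x /= xN; apply: hN => /= cx; apply: xN.
rewrite mulmxKV// in cx; apply: cvg_trans cx; apply: near_eq_cvg.
have : \forall t \near (0 : R)^', t != 0 by exact: nbhs_dnbhs_neq.
by apply: filterS => t t0; rewrite corner_sum.
Qed.

End inversion_ae.

(** * Continuous functions on row vectors *)

Section continuous_functions.
Context {R : realType} (n : nat).
Implicit Types (h : 'rV[R]_n -> R).

(** An open set is the union of the rational cubes that it contains. *)
Lemma open_measurable_rV (O : set 'rV[R]_n) : open O -> measurable O.
Proof.
move=> oO.
pose P (i : 'rV[rat]_n * rat) :
  set 'rV[R]_n := open_cube (map_mx ratr i.1) (ratr i.2).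
pose C (k : nat) := if @choice.unpickle ('rV[rat]_n * rat)%type k is Some i then
  (if `[< P i `<=` O >] then P i else set0) else set0.
rewrite (_ : O = \bigcup_k C k).
  apply: bigcupT_measurable => k; rewrite /C; case: unpickle => // i.
  by case: ifP => // _; exact: measurable_open_cube.
apply/seteqP; split => [z Oz|z [k _]]; last first.
  by rewrite /C; case: unpickle => // i; case: ifPn => // /asboolP; apply.
have /nbhs_ballP[e /= e0 eO] : nbhs z O by exact: open_nbhs_nbhs.
have e4 : 0 < e / 4 by rewrite divr_gt0.
have [q [r [r0 re qz _]]] := rational_cube z e4.
exists (pickle (q, r)) => //; rewrite /C pickleK; rewrite ifT//.
apply/asboolP => y qy; apply: eO; rewrite mx_norm_ball /ball_/=.
apply: (@le_lt_trans _ _ (e / 2)); last by lra.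
apply: mx_norm_le_coord => [|i]; first lra.
rewrite !mxE; have := qy i; have := qz i.
by rewrite /= !ltr_norml => /andP[? ?] /andP[? ?]; rewrite ler_norml;
  apply/andP; split; lra.
Qed.

Lemma continuous_measurable_rV h : continuous h -> measurable_fun setT h.
Proof.
move=> /continuousP ch; apply: (measurability _ (RGenOpens.measurableE R)).
move=> _ [_ [a [b ->]] <-]; rewrite setTI; apply: open_measurable_rV.
by apply: ch; exact: interval_open.
Qed.

End continuous_functions.

Section bounded_support.
Context d (T : measurableType d) {R : realType}.
Variable mu : {measure set T -> \bar R}.

Lemma integrable_bounded_support (h : T -> R) (A : set T) (K : R) :
  measurable_fun setT h -> measurable A -> (mu A < +oo)%E ->
  (forall x, `|h x| <= K) -> (forall x, h x != 0 -> A x) ->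
  mu.-integrable setT (EFin \o h).
Proof.
move=> mh mA Aoo hK hA; apply/integrableP; split; first exact/measurable_EFinP.
apply: (@le_lt_trans _ _ (\int[mu]_(x in A) cst K%:E x)%E); last first.
  have K0 : 0 <= K \/ A = set0.
    have [->|/set0P[x _]] := eqVneq A set0; first by right.
    by left; apply: le_trans (hK x).
  rewrite integral_cst//; case: K0 => [K0|->]; last by rewrite measure0 mule0.
  by rewrite lte_mul_pinfty ?lee_fin.
rewrite [leRHS]integral_mkcond; apply: ge0_le_integral => //.
- by apply: measurableT_comp => //; exact/measurable_EFinP.
- by apply/(measurable_restrictT _ mA).
- move=> x _; rewrite patchE /=; case: ifPn => [_|/negP xA];
    first by rewrite lee_fin.
  have [->|hx] := eqVneq (h x) 0; first by rewrite normr0.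
  by case: xA; exact/mem_set/hA.
Qed.

End bounded_support.

(** * Integrals along rays *)

Section ray_integrals.
Context {R : realType} (m : nat) (u : 'I_m.+1 -> 'rV[R]_m.+1).
Hypothesis hu : unit_basis u.
Local Notation n := m.+1.
Local Notation U := (\matrix_i u i).
Local Notation coord y := ((y : 'rV[R]_n) *m invmx U).
Notation leb1 := (@lebesgue_measure R).
Notation leb := (lebesgue_rV :
  forall n, {sigma_finite_measure set 'rV[R]_n -> \bar R}).
Implicit Types (h : 'rV[R]_n -> R) (x w : 'rV[R]_n) (i : 'I_n).

Lemma continuous_bounded_on_compact (T : topologicalType) (g : T -> R) (C : set T) :
  continuous g -> compact C -> exists K, 0 <= K /\ forall c, C c -> `|g c| <= K.
Proof.
move=> cg cC.
have cgC : compact (g @` C).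
  by apply: continuous_compact => //; exact: continuous_subspaceT.
have /ex_strict_bound_gt0[K K0 gK] := compact_bounded (cgC : compact (g @` C :
  set R^o)).
exists K; split; first exact: ltW.
by move=> c Cc; apply/ltW/gK; exists c.
Qed.

(** A class stable under integration along the rays of the cone: the support may
    be unbounded, but only in the directions opposite to the rays. *)
Definition cone_supported h :=
  continuous h /\ exists b, forall x, h x != 0 -> forall i, coord x ord0 i <= b.

Definition ray_integral w h x : R :=
  \int[leb1]_(s in `[0, +oo[) h (x + s *: w).

Lemma line_continuous x w : continuous (fun s : R => x + s *: w).
Proof.
by move=> s; apply: cvgD; [exact: cvg_cst|apply: cvgZr_tmp; exact: cvg_id].
Qed.

Lemma coord_line x i (s : R) : coord (x + s *: u i) ord0 i = coord x ord0 i + s.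
Proof.
by rewrite -[s *: u i]opprK coordB -scaleNr coordZ (coord_edge hu) eqxx mulr1 opprK.
Qed.

Lemma line_integrable h x i (y : R) : cone_supported h ->
  leb1.-integrable `]-oo, y] (EFin \o (fun s => h (x + s *: - u i))).
Proof.
move=> [ch [b hb]].
have cg : continuous (fun s : R => h (x + s *: - u i)).
  by move=> s; apply: continuous_comp; [exact: line_continuous|exact: ch].
pose A : set (measurableTypeR R) := `[coord x ord0 i - b, y]%classic.
have [K [K0 gK]] := continuous_bounded_on_compact cg (@segment_compact R
  (coord x ord0 i - b) y).
have mI : measurable (`]-oo, y]%classic : set (measurableTypeR R)) by exact:
  measurable_itv.
have := integrable_mkcond (mu := leb1) (EFin \o (fun s => h (x + s *: - u i))) mI.
rewrite restrict_EFin => /iffRL; apply.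
apply: (@integrable_bounded_support _ _ _ _ _ A K).
- apply/(measurable_restrictT _ (measurable_itv _)); apply: measurable_funTS.
  exact: continuous_measurable_fun.
- exact: measurable_itv.
- by rewrite [ltLHS](lebesgue_measure_itv `[coord x ord0 i - b, y])/=;
    case: ifP; rewrite ?ltry.
- move=> s; rewrite patchE; case: ifPn; rewrite ?normr0// => /set_mem/=.
  rewrite in_itv/= => sy.
  have [->|hs] := eqVneq (h (x + s *: - u i)) 0; first by rewrite normr0.
  apply: gK; rewrite /= in_itv/= sy andbT.
  have := hb _ hs i; rewrite scalerN -scaleNr coord_line; lra.
- move=> s; rewrite patchE; case: ifPn; rewrite ?eqxx// => /set_mem/=.
  rewrite /A /= !in_itv/= => sy hs; rewrite sy andbT.
  have := hb _ hs i; rewrite scalerN -scaleNr coord_line; lra.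
Qed.

(** Substituting r - s for s: moving the vertex against the ray extends the
    domain of integration, which is what makes the derivative computable. *)
Lemma ray_integral_line h x w (r : R) : continuous h ->
  ray_integral w h (x + r *: - w) = \int[leb1]_(s in `]-oo, r]) h (x + s *: - w).
Proof.
move=> ch; rewrite /ray_integral [LHS]Rintegral_mkcond [RHS]Rintegral_mkcond;
  congr fine.
pose k := (fun s : R => h (x + s *: - w)) \_ `]-oo, r].
rewrite -[RHS](@integral_comp1 _ _ _ _ _ leb1 leb1 (fun s => (-1) ^+ true * s + r)).
- apply: eq_integral => s _; rewrite /= /k !patchE; congr EFin.
  rewrite !mem_setE !in_itv/= andbT expr1 mulN1r gerDr oppr_le0.
  case: ifP => // _; congr (h _).
  by rewrite -addrA; congr (_ + _); rewrite scalerDl !scalerN scaleNr opprK addrC.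
- exact: (measurable_signed_shift true r).
- exact: (lebesgue_measure_signed_shift true r).
- apply/measurable_EFinP/(measurable_restrictT _ (measurable_itv _)).
  apply: measurable_funTS; apply: continuous_measurable_fun => s.
  by apply: continuous_comp; [exact: line_continuous|exact: ch].
Qed.

(** The fundamental theorem of calculus on the line through x. *)
Lemma derive_ray_integral h x i : cone_supported h ->
  derivable (ray_integral (u i) h) x (- u i) /\
  'D_(- u i) (ray_integral (u i) h) x = h x.
Proof.
move=> sh; have [ch _] := sh.
pose k (s : R) := h (x + s *: - u i).
pose phi (r : R) : R := \int[leb1]_(s in `]-oo, r]) k s.
have [dphi dphiE] : derivable phi 0 1 /\ derive1 phi 0 = k 0.
  apply: (continuous_FTC1 (u := 1)) => //.
  - exact: line_integrable.
  - by rewrite ltNyr.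
  - suff ck : continuous k by exact: ck.
    by move=> s; apply: continuous_comp; [exact: line_continuous|exact: ch].
have E : (fun r : R => r^-1 *: ((ray_integral (u i) h \o shift x) (r *: - u i) -
    ray_integral (u i) h x)) =
    (fun r : R => r^-1 *: ((phi \o shift 0) (r *: 1) - phi 0)).
  apply/funext => r /=; rewrite addr0 [r *: 1]mulr1 /phi /k.
  rewrite -!ray_integral_line//.
  congr (_ *: (ray_integral _ _ _ - ray_integral _ _ _)).
    by rewrite addrC.
  by rewrite scale0r addr0.
split; first by rewrite /derivable E; exact: dphi.
rewrite /derive E; have := dphiE; rewrite derive1E /derive => ->.
by rewrite /k scale0r addr0.
Qed.

End ray_integrals.

(** * Iterated integrals along rays *)

Section iterated_ray_integrals.
Context {R : realType} (m : nat) (u : 'I_m.+1 -> 'rV[R]_m.+1).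
Hypothesis hu : unit_basis u.
Local Notation n := m.+1.
Local Notation U := (\matrix_i u i).
Local Notation coord y := ((y : 'rV[R]_n) *m invmx U).
Notation leb1 := (@lebesgue_measure R).
Notation leb := (lebesgue_rV :
  forall n, {sigma_finite_measure set 'rV[R]_n -> \bar R}).
Implicit Types (h : 'rV[R]_n -> R) (x w : 'rV[R]_n) (i : 'I_n).

Lemma ray_integral_segment h x i (b S : R) : 0 <= S ->
  (forall y, h y != 0 -> coord y ord0 i <= b) -> b - coord x ord0 i <= S ->
  ray_integral (u i) h x = \int[leb1]_(s in `[0, S]) h (x + s *: u i).
Proof.
move=> S0 hb bS; rewrite /ray_integral [LHS]Rintegral_mkcond [RHS]Rintegral_mkcond.
apply: eq_Rintegral => s _; rewrite !patchE !mem_setE !in_itv/= andbT.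
case: ifPn => s0 //=; case: ifPn => // sS.
apply/eqP; apply: contraNT sS => /hb.
by rewrite coord_line// => ?; lra.
Qed.

(** Tube lemma for the compact segment. *)
Lemma near_uniform_on_segment h x0 w (S e : R) : continuous h -> 0 < e ->
  \forall x \near x0, forall s : R, `[0, S]%classic s ->
    `|h (x0 + s *: w) - h (x + s *: w)| <= e.
Proof.
move=> ch e0.
have cover := (compact_near_coveringP `[0, S]%classic).1 (@segment_compact R 0 S).
apply: (cover _ (nbhs x0)
  (fun x (s : R) => `|h (x0 + s *: w) - h (x + s *: w)| <= e) (nbhs_filter x0)).
move=> s _.
have c1 : (x0 + p.1 *: w) @[p --> (s, x0)] --> x0 + s *: w.
  by apply: cvgD; [exact: cvg_cst|apply: cvgZr_tmp; exact: cvg_fst].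
have c2 : (p.2 + p.1 *: w) @[p --> (s, x0)] --> x0 + s *: w.
  by apply: cvgD; [exact: cvg_snd|apply: cvgZr_tmp; exact: cvg_fst].
have c3 : (h (x0 + p.1 *: w) - h (p.2 + p.1 *: w)) @[p --> (s, x0)] --> (0 : R).
  rewrite -(subrr (h (x0 + s *: w))).
  by apply: cvgB; [apply: (cvg_comp _ _ c1)|apply: (cvg_comp _ _ c2)]; exact: ch.
move/cvgrPdist_le : c3 => /(_ _ e0).
by apply: filterS => p; rewrite sub0r normrN.
Qed.

(** Near x0 the integrals are taken over a common segment, on which h is
    uniformly close to its translate. *)
Lemma cone_supported_ray_integral h i :
  cone_supported u h -> cone_supported u (ray_integral (u i) h).
Proof.
move=> [ch [b hb]]; split; last first.
  exists b => x hx k; rewrite leNgt; apply/negP => bk; move/eqP: hx; apply.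
  rewrite /ray_integral Rintegral_mkcond (_ : _ \_ _ = fun=> 0).
    by rewrite /Rintegral integral0.
  apply/funext => s; rewrite patchE; case: ifPn => // /set_mem/=.
  rewrite in_itv/= andbT => s0; apply/eqP; apply: contraTT bk => /hb/(_ k).
  rewrite -leNgt -[s *: u i]opprK (coordB u) -scaleNr (coordZ u) (coord_edge hu).
  have := ler0n R (k == i); have : 0 <= s * (k == i)%:R by rewrite mulr_ge0.
  lra.
move=> x0; have Fx0 := nbhs_filter x0; apply/cvgrPdist_le => e e0.
(* The margin 1 absorbs the variation of the coordinate for x near x0. *)
pose S := `|b - coord x0 ord0 i| + 1.
have S0 : 0 < S by rewrite ltr_wpDl.
have near_i : \forall x \near x0, coord x0 ord0 i - 1 < coord x ord0 i.
  have := @mulmx_entry_continuous R m (invmx U) i x0.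
  by move/cvgr_gt; apply; rewrite ltrBlDr ltrDl.
have eS : 0 < e / S by rewrite divr_gt0.
have := near_uniform_on_segment x0 (u i) S ch eS.
apply: filterS2 near_i => x xi hx.
have hbi y : h y != 0 -> coord y ord0 i <= b by move=> /hb.
have ? := ler_norm (b - coord x0 ord0 i).
rewrite (ray_integral_segment (ltW S0) hbi (x := x0)); last by rewrite /S; lra.
rewrite (ray_integral_segment (ltW S0) hbi (x := x)); last by rewrite /S; lra.
have ig y : leb1.-integrable `[0, S] (EFin \o (fun s : R => h (y + s *: u i))).
  apply: continuous_compact_integrable; first exact: segment_compact.
  apply: continuous_subspaceT => s.
  by apply: continuous_comp; [exact: line_continuous|exact: ch].
have mI : measurable (`[0, S]%classic : set (measurableTypeR R)) by exact:
  measurable_itv.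
rewrite -RintegralB//.
have ig2 : leb1.-integrable `[0, S]
    (EFin \o (fun s : R => h (x0 + s *: u i) - h (x + s *: u i))).
  by have := integrableB mI (ig x0) (ig x); apply: eq_integrable.
apply: le_trans (le_normr_Rintegral mI ig2) _.
apply: (@le_trans _ _ (\int[leb1]_(s in `[0, S]) (e / S))).
  apply: le_Rintegral => //.
  - exact: (integrable_norm ig2).
  - apply: (@continuous_compact_integrable R (fun=> e / S)) => //.
      exact: segment_compact.
    by apply: continuous_subspaceT => s; exact: cvg_cst.
rewrite Rintegral_cst// [X in fine X](lebesgue_measure_itv `[0, S])/= lte_fin S0
  sube0/=.
by rewrite mulfVK// gt_eqF.
Qed.

(** The directions are u_(w j): letting k vary allows a recursion that removes
    one direction at a time. *)
Definition orthant_integral k (w : 'I_k -> 'I_n) h x : R :=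
  \int[leb k]_(c in orthant k) h (x + \sum_j c ord0 j *: u (w j)).

Lemma orthant_param_continuous k (w : 'I_k -> 'I_n) x :
  continuous (fun c : 'rV[R]_k => x + \sum_j c ord0 j *: u (w j)).
Proof.
move=> c; have Fc := nbhs_filter c.
apply: cvgD; first exact: cvg_cst.
apply: cvg_big => [|j _]; first exact: add_continuous.
apply: cvgZr_tmp; exact: (@coord_continuous R 1 k ord0 j c).
Qed.

(** On the orthant the support condition bounds every parameter, so that the
    integrand is bounded with compact support. *)
Lemma orthant_integrable k (w : 'I_k -> 'I_n) h x : cone_supported u h ->
  (leb k).-integrable setT
    (EFin \o ((fun c => h (x + \sum_j c ord0 j *: u (w j))) \_ (orthant k))).
Proof.
move=> [ch [b hb]].
pose g (c : 'rV[R]_k) := h (x + \sum_j c ord0 j *: u (w j)).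
have cg : continuous g.
  by move=> c; apply: continuous_comp; [exact: orthant_param_continuous|exact: ch].
pose S := \sum_i `|b - coord x ord0 i|.
have gS c : orthant k c -> g c != 0 -> forall j, 0 <= c ord0 j <= S.
  move=> c0 gc j; rewrite c0/=.
  have := hb _ gc (w j).
  have -> : coord (x + \sum_l c ord0 l *: u (w l)) ord0 (w j) =
      coord x ord0 (w j) + \sum_l c ord0 l * (w j == w l)%:R.
    rewrite mulmxDl mulmx_suml [LHS]mxE summxE; congr (_ + _).
    by apply: eq_bigr => l _; rewrite (coordZ u) (coord_edge hu).
  have : c ord0 j <= \sum_l c ord0 l * (w j == w l)%:R.
    rewrite (bigD1 j)//= eqxx mulr1 lerDl sumr_ge0// => l _.
    by rewrite mulr_ge0 ?ler0n.
  have : `|b - coord x ord0 (w j)| <= S.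
    by rewrite /S (bigD1 (w j))//= lerDl sumr_ge0.
  have := ler_norm (b - coord x ord0 (w j)); lra.
pose C : set 'rV[R]_k := [set c | forall j, `[0, S]%classic (c ord0 j)].
have cC : compact C by apply: (@rV_compact _ k (fun=> `[0, S]%classic)) => j;
  exact: segment_compact.
have [K [K0 gK]] := continuous_bounded_on_compact cg cC.
have mC : measurable C by apply:
  (@measurable_box R k (fun=> `[0, S]%classic)) => j; exact: measurable_itv.
apply: (@integrable_bounded_support _ _ _ _ _ C K).
- apply/(measurable_restrictT _ (@measurable_orthant R k)); apply: measurable_funTS.
  exact: continuous_measurable_rV.
- exact: mC.
- rewrite [ltLHS](@lebesgue_rV_box R k (fun=> `[0, S]%classic));
    last by move=> j; exact: measurable_itv.
  rewrite -ge0_fin_numE ?prode_ge0//; apply/prode_fin_num => j _.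
  by rewrite lebesgue_measure_itv/=; case: ifP.
- move=> c; rewrite patchE; case: ifPn; rewrite ?normr0// => /set_mem cO.
  have [->|gc] := eqVneq (h (x + \sum_j c ord0 j *: u (w j))) 0;
    first by rewrite normr0.
  by apply: gK => j; rewrite /= in_itv/=; exact: gS.
- move=> c; rewrite patchE; case: ifPn; rewrite ?eqxx// => /set_mem cO gc j.
  by rewrite /= in_itv/=; exact: gS.
Qed.

Lemma orthant_integral0 (w : 'I_0 -> 'I_n) h x : orthant_integral w h x = h x.
Proof.
rewrite /orthant_integral Rintegral_mkcond /Rintegral.
have O0 c : c \in orthant 0 by apply/mem_set => -[].
under eq_integral => c _ do rewrite patchE O0 big_ord0 addr0.
by rewrite integral_cst// [X in (_ * X)%E]diracT mule1.
Qed.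

(** Fubini: the first direction is integrated first, although the measure is
    built with the first coordinate outermost. *)
Lemma orthant_integralS k (w : 'I_k.+1 -> 'I_n) h : cone_supported u h ->
  orthant_integral w h =
  orthant_integral (w \o lift ord0) (ray_integral (u (w ord0)) h).
Proof.
move=> sh; apply/funext => x; have ig := orthant_integrable w x sh.
pose g := (fun c => h (x + \sum_j c ord0 j *: u (w j))) \_ (orthant k.+1).
pose psi (p : 'rV[R]_k * measurableTypeR R) := cons_rV (p.2, p.1).
have mpsi : measurable_fun setT psi.
  exact: measurableT_comp (@measurable_cons_rV R k) (@measurable_pair_swap _ _ _ _).
have psiE E : measurable E -> (leb k \x leb1)%E (psi @^-1` E) = leb k.+1 E.
  move=> mE; have mcE : measurable (@cons_rV R k @^-1` E).
    by rewrite -[X in measurable X]setTI; exact: measurable_cons_rV.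
  exact: (product_measure_swap leb1 (leb k) mcE).
rewrite /orthant_integral [LHS]Rintegral_mkcond -/g.
have -> : \int[leb k.+1]_c g c = \int[(leb k \x leb1)%E]_p g (psi p).
  congr fine; apply/esym.
  exact: (integral_comp1 mpsi psiE (measurable_int _ ig)).
rewrite -Rintegral12; last exact: (integrable_comp1 mpsi psiE ig).
rewrite [RHS]Rintegral_mkcond; apply: eq_Rintegral => c _.
have cons0 s : psi (c, s) ord0 ord0 = s by rewrite mxE unlift_none.
have consL s j : psi (c, s) ord0 (lift ord0 j) = c ord0 j by rewrite mxE liftK.
have gE s : g (psi (c, s)) = if (0 <= s) && (c \in orthant k) then
    h (x + (\sum_j c ord0 j *: u (w (lift ord0 j))) + s *: u (w ord0)) else 0.
  rewrite /g patchE (_ : (_ \in _) = (0 <= s) && (c \in orthant k)).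
    case: ifP => // _; congr h; rewrite big_ord_recl cons0 -addrA; congr (_ + _).
    by rewrite addrC; congr (_ + _); apply: eq_bigr => j _; rewrite consL.
  apply/idP/andP => [/set_mem cO|[s0 /set_mem cO]].
    split; first by have := cO ord0; rewrite cons0.
    by apply/mem_set => j; have := cO (lift ord0 j); rewrite consL.
  apply/mem_set => i; case: (unliftP ord0 i) => [j ->|->].
    by rewrite consL; exact: cO.
  by rewrite cons0.
rewrite patchE; case: ifPn => cO; last first.
  rewrite (_ : (fun s => _) = fun=> 0) /Rintegral ?integral0//.
  by apply/funext => s; rewrite gE (negbTE cO) andbF.
rewrite /ray_integral [RHS]Rintegral_mkcond; apply: eq_Rintegral => s _.
by rewrite gE cO andbT patchE mem_setE in_itv/= andbT.
Qed.

(** The outermost derivative is along the direction integrated first, hence the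
    induction peels the derivatives from the inside: the inner ones recover the
    ray integral, and the last one recovers h. *)
Lemma iter_derive_orthant_integral k (w : 'I_k -> 'I_n) h (v : 'I_n -> 'rV[R]_n) :
  (forall i, v i = - u i) -> cone_supported u h ->
  iter_derivable [seq v (w j) | j <- enum 'I_k] (orthant_integral w h) /\
  iter_derive [seq v (w j) | j <- enum 'I_k] (orthant_integral w h) = h.
Proof.
move=> hv; elim: k => [|k ih] in w h * => sh.
  rewrite enum_ord0 /=; split => //; apply/funext => x; exact: orthant_integral0.
rewrite enum_ordSl /= -map_comp (orthant_integralS w sh).
have sJ := cone_supported_ray_integral (w ord0) sh.
have [dJ eJ] := ih (w \o lift ord0) _ sJ.
rewrite /= in dJ eJ.
split; first split => //.
  by rewrite eJ hv => x; have [] := derive_ray_integral hu x (w ord0) sh.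
rewrite eJ hv; apply/funext => x.
by have [_ ->] := derive_ray_integral hu x (w ord0) sh.
Qed.

End iterated_ray_integrals.

(** * Inversion for continuous functions *)

Section inversion_continuous.
Context {R : realType} (m : nat) (u v : 'I_m.+1 -> 'rV[R]_m.+1).
Context (alpha y1 : 'rV[R]_m.+1) (beta : R).
Hypothesis hu : unit_basis u.
Hypothesis halpha : cone_axis u alpha beta.
Hypothesis hy1 : face_normal u alpha beta ord0 y1.
Hypothesis hv : forall i, v i = - u i.
Local Notation n := m.+1.
Local Notation U := (\matrix_i u i).

Lemma Cc_support_bounded (f : 'rV[R]_n -> R) : Cc f ->
  exists M, 0 < M /\ forall x, f x != 0 -> `|x| <= M.
Proof.
move=> [_ cf].
have [M M0 fM] := ex_strict_bound_gt0 (compact_bounded cf).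
exists M; split => // x fx; apply/ltW/fM; exact: subset_closure.
Qed.

Lemma Cc_L1 (f : 'rV[R]_n -> R) : Cc f -> L1 f.
Proof.
move=> Cf; have [cf kf] := Cf.
have [M [M0 fM]] := Cc_support_bounded Cf.
have [K [K0 fK]] := continuous_bounded_on_compact cf kf.
apply: (@integrable_bounded_support _ _ _ _ _ (open_cube 0 (M + 1)) K).
- exact: continuous_measurable_rV.
- exact: measurable_open_cube.
- exact: lebesgue_open_cube_lty.
- move=> x; have [->|fx] := eqVneq (f x) 0; first by rewrite normr0.
  by apply: fK; exact: subset_closure.
- move=> x /fM xM i; rewrite mxE subr0.
  by apply: le_lt_trans (le_trans (ler_coord_norm x i) xM) _; rewrite ltrDl.
Qed.

Lemma Cc_cone_supported (f : 'rV[R]_n -> R) (c : R) : Cc f ->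
  cone_supported u (fun x => c * f x).
Proof.
move=> Cf; have [cf _] := Cf; have [M [M0 fM]] := Cc_support_bounded Cf.
split.
  by move=> x; have Fx := nbhs_filter x; apply: cvgM; [exact: cvg_cst|exact: cf].
exists (\sum_i \sum_j M * `|invmx U j i|) => x.
rewrite mulf_eq0 negb_or => /andP[_ /fM xM] i.
rewrite mxE; apply: le_trans (ler_norm _) _; apply: le_trans (ler_norm_sum _ _ _) _.
apply: (@le_trans _ _ (\sum_j M * `|invmx U j i|)).
  apply: ler_sum => j _; rewrite normrM ler_wpM2r//.
  exact: le_trans (ler_coord_norm x j) xM.
rewrite [leRHS](bigD1 i)//= lerDl sumr_ge0// => k _; rewrite sumr_ge0// => j _.
by rewrite mulr_ge0// ltW.
Qed.

Theorem iter_derive_axis_transform f : Cc f ->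
  let F := axis_transform u alpha y1 f in
  let vs := [seq v i | i <- enum 'I_n] in
  iter_derivable vs F /\
  forall x, f x = `|\det (\matrix_i v i)|^-1 * iter_derive vs F x.
Proof.
move=> Cf; have if_ := Cc_L1 Cf.
have FE : axis_transform u alpha y1 f =
    orthant_integral u id (fun x => `|\det U| * f x).
  apply/funext => x; rewrite (axis_transform_cone hu halpha hy1)//.
  rewrite /orthant_integral RintegralZl//.
  - by congr (_ * _); apply: eq_Rintegral => c _; rewrite (mulmx_rows u).
  - exact: measurable_orthant.
  - apply: (integrableS measurableT) => //; first exact: measurable_orthant.
    have := L1_affine x (basis_unitmx hu) if_.
    by apply: eq_integrable => // c _; rewrite /= (mulmx_rows u).
have [dF eF] := iter_derive_orthant_integral hu id hv
  (Cc_cone_supported `|\det U| Cf).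
rewrite FE; split => [|x]; first exact: dF.
rewrite eF (norm_det_opp hv) mulKf//.
by rewrite normr_eq0 -unitfE -unitmxE basis_unitmx.
Qed.

End inversion_continuous.

(** * The inversion formulas *)

Theorem corollary3 (R : realType) (m : nat)
    (u v : 'I_m.+1 -> 'rV[R]_m.+1) (alpha y1 : 'rV[R]_m.+1) (beta : R)
    (hu : unit_basis u)
    (halpha : cone_axis u alpha beta)
    (hy1 : face_normal u alpha beta ord0 y1)
    (hv : forall i, v i = - u i) :
  (forall f : 'rV[R]_m.+1 -> R, L1 f ->
     {ae lebesgue_rV m.+1, forall x,
        (t ^+ m.+1 * `|\det (\matrix_i v i)|)^-1 *
          (\sum_(s : {ffun 'I_m.+1 -> bool})
             Num.sg (\prod_i (half_sign (s i) : R)) *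
             axis_transform u alpha y1 f
               (x + \sum_i (half_sign (s i) * t) *: v i))
        @[t --> 0^'] --> f x}) /\
  (forall f : 'rV[R]_m.+1 -> R, Cc f ->
     let F := axis_transform u alpha y1 f in
     let vs := [seq v i | i <- enum 'I_m.+1] in
     iter_derivable vs F /\
     forall x, f x = `|\det (\matrix_i v i)|^-1 * iter_derive vs F x).
Proof.
split=> f hf; first exact: corner_sum_ae hu halpha hy1 hv f hf.
exact: iter_derive_axis_transform hu halpha hy1 hv f hf.
Qed.
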